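(* Let $c>0$ and $c_1=|\Gamma(-\tfrac14)|$. Let $b_0$ be a smooth function on $[0,\infty)$, rapidly decaying together with all its derivatives as $t\to\infty$, with $b_0(t)=0$ for $t<0$. Then the equation $$b(t)=b_0(t)-cc_1\,\big(\Phi_{-1/4}\star b\big)(t)$$ has a unique solution $b$ in $C(0,T)$ for any $T>0$. This solution can be obtained by iterations: with $$\beta_0=(cc_1)^{-1}\Phi_{1/4}\star b_0,\qquad \beta_{n+1}=-(cc_1)^{-1}\Phi_{1/4}\star\beta_n+(cc_1)^{-1}\Phi_{1/4}\star b_0\quad(n\ge 0),$$ one has $b=\lim_{n\to\infty}\beta_n$.
   Context: $C(0,T)$ is the Banach space of continuous functions on $[0,T]$ with the sup norm. For $\lambda\in\mathbb{C}$, $\Phi_\lambda(t):=\frac{t_+^{\lambda-1}}{\Gamma(\lambda)}$, where $t_+=t$ for $t\ge0$ and $t_+=0$ for $t<0$. For $\lambda>0$, $(\Phi_\lambda\star b)(t)=\int_0^t\Phi_\lambda(t-s)b(s)\,ds$ classically. For $\lambda\le 0$ this integral diverges classically and the convolution is defined through the Laplace transform $L(b)(p)=\int_0^\infty e^{-pt}b(t)\,dt$: one has $L(\Phi_\lambda)=p^{-\lambda}$ for $\lambda>0$, and this is extended to the other values of $\lambda$ by analytic continuation in $\lambda$; then $\Phi_\lambda\star b:=L^{-1}\big(p^{-\lambda}L(b)\big)$. In particular $L(\Phi_{-1/4}\star b)=p^{1/4}L(b)$. With this definition the equation is the interpretation of the hyper-singular equation $b(t)=b_0(t)+c\int_0^t(t-s)^{-5/4}b(s)\,ds$,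 since $\Gamma(-\tfrac14)=-c_1<0$. *)

(* Defs.v *)
From HB Require Import structures.
From mathcomp Require Import all_boot all_order all_algebra.
From mathcomp Require Import all_classical all_reals all_analysis.
From mathcomp.real_closed Require Import complex.

Set Implicit Arguments.
Unset Strict Implicit.
Unset Printing Implicit Defensive.

Import Order.TTheory GRing.Theory Num.Theory.
Import numFieldNormedType.Exports.

Local Open Scope classical_set_scope.
Local Open Scope ring_scope.
Local Open Scope complex_scope.

Section Gamma_and_Phi.
Context {R : realType}.
Implicit Types (x t lambda : R) (b : R -> R).

Definition Gamma_int x : R :=
  \int[lebesgue_measure]_(t in `]0, +oo[) (t `^ (x - 1) * expR (- t)).

(* Euler's integral for x > 0, continued to x <= 0 by the functional equation
   Gamma x = Gamma (x + n) / (x (x + 1) ... (x + n - 1)), with n least such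
   that x + n > 0.  At the poles x = 0, -1, -2, ... the value is 0, so that
   1 / Gamma vanishes there as it should. *)
Definition Gamma x : R :=
  let n := if 0 < x then 0%N else (Num.truncn (- x)).+1 in
  Gamma_int (x + n%:R) / \prod_(k < n) (x + k%:R).

(* The test is needed because 0 `^ 0 = 1, which would make Phi 1 equal to 1 on
   the negative half-line. *)
Definition Phi lambda t : R :=
  if 0 <= t then t `^ (lambda - 1) / Gamma lambda else 0.

(* The classical convolution, for lambda > 0. *)
Definition Phi_conv lambda b t : R :=
  \int[lebesgue_measure]_(s in `[0, t]) (Phi lambda (t - s) * b s).

End Gamma_and_Phi.

Section Laplace.
Context {R : realType}.
Implicit Types (p z a : R[i]) (sigma lambda : R) (b v : R -> R).

Definition cexp z : R[i] :=
  (expR (complex.Re z) * cos (complex.Im z))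
  +i* (expR (complex.Re z) * sin (complex.Im z)).

(* The principal logarithm on the half-plane Re p > 0, where
   Arg p = atan (Im p / Re p). It is only used there. *)
Definition clog p : R[i] :=
  ln (Normc.normc p) +i* atan (complex.Im p / complex.Re p).

Definition cpow p a : R[i] := cexp (a * clog p).

Definition cRintegral (D : set R) (f : R -> R[i]) : R[i] :=
  (\int[lebesgue_measure]_(t in D) complex.Re (f t))
  +i* (\int[lebesgue_measure]_(t in D) complex.Im (f t)).

Definition laplace b p : R[i] :=
  cRintegral `[0, +oo[ (fun t => cexp (- p * t%:C) * (b t)%:C).

(* Absolute convergence of the Laplace integral on Re p >= sigma. *)
Definition laplace_integrable sigma b : Prop :=
  lebesgue_measure.-integrable `[0, +oo[
    (fun t => (expR (- sigma * t) * b t)%:E).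

(* v is (a representative of) L^-1(p^(-lambda) L(b)): the Laplace integrals of
   b and of v converge on some right half-plane, and there
   L(v)(p) = p^(-lambda) L(b)(p). A relation, because L determines v only up to
   a null set. *)
Definition Phi_conv_laplace lambda b v : Prop :=
  exists sigma : R,
    [/\ 0 <= sigma, laplace_integrable sigma b, laplace_integrable sigma v &
        forall p, sigma < complex.Re p ->
          laplace v p = cpow p (- lambda)%:C * laplace b p].

End Laplace.

Section Equation.
Context {R : realType}.
Implicit Types (c : R) (b f g : R -> R) (I : set R).

(* g is the derivative of f relative to the half-line [0, +oo[, i.e. the
   right derivative at 0 and the usual one elsewhere. *)
Definition halfline_derivative f g : Prop :=
  forall t, 0 <= t ->
    (f s - f t) / (s - t) @[s --> within [set s | 0 <= s] t^'] --> g t.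

(* d n is the n-th derivative of f on [0, +oo[. *)
Definition smooth_rapidly_decaying f : Prop :=
  exists d : nat -> R -> R,
    [/\ d 0%N = f,
        forall n, halfline_derivative (d n) (d n.+1) &
        forall n m, exists M, forall t, 0 <= t -> t ^+ m * `|d n t| <= M].

Definition c1 : R := `|Gamma (- (1 / 4))|.

(* b is a continuous function on I which solves
   b = b0 - c c1 (Phi_(-1/4) * b) on I, for I = [0, T] or I = [0, +oo[.
   The Laplace transform needs a function on [0, +oo[: for I = [0, T],
   Phi_(-1/4) * b is the restriction to [0, T] of Phi_(-1/4) * u, where u is
   any Laplace-transformable extension of b. By causality it does not depend
   on u. *)
Definition solution_on I c (b0 : R -> R) b : Prop :=
  {within I, continuous b} /\
  exists u v : R -> R,
    [/\ {in I, u =1 b}, Phi_conv_laplace (- (1 / 4)) u v &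
        {in I, forall t, b t = b0 t - c * c1 * v t}].

Fixpoint beta c (b0 : R -> R) (n : nat) : R -> R :=
  match n with
  | 0%N => fun t => (c * c1)^-1 * Phi_conv (1 / 4) b0 t
  | n'.+1 => fun t => - (c * c1)^-1 * Phi_conv (1 / 4) (beta c b0 n') t
                      + (c * c1)^-1 * Phi_conv (1 / 4) b0 t
  end.

End Equation.

(* Main.v *)
Require Import Defs.
From mathcomp Require Import all_boot all_order all_algebra.
From mathcomp Require Import all_classical all_reals all_analysis.
From mathcomp Require Import measurable_realfun.
From mathcomp.real_closed Require Import complex.
From mathcomp Require Import ring lra.

Set Implicit Arguments.
Unset Strict Implicit.
Unset Printing Implicit Defensive.

Import Order.TTheory GRing.Theory Num.Theory.
Import numFieldNormedType.Exports.

Local Open Scope classical_set_scope.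
Local Open Scope ring_scope.

(** Write k = c c1 > 0 and a = 1/4. Multiplication by p^a is inverted by
    multiplication by p^(-a), which is convolution with Phi_a. Hence
    b = b0 - k v with L(v) = p^a L(b) says that v = (b0 - b) / k and
    b = Phi_a * v, which is the Volterra equation of the second kind
<<
      b = k^-1 Phi_a * (b0 - b),
>>
    with a kernel that is only weakly singular. The functions beta_n are its
    Picard iterates.

    The Volterra equation is solved in the norms sup e^(-sigma t) |f(t)|: since
    the integral of Phi_a(t) e^(-sigma t) is sigma^(-a), the map
    f |-> k^-1 Phi_a * f is a contraction with factor k^-1 sigma^(-a), at most
    1/2 for sigma large ([tame_contract]). This gives the convergence of the
    iterates, uniform on every [0, T], to a continuous solution of growth at
    most e^(sigma t) ([volterra_solution]), and uniqueness on every [0, T]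
    ([volterra_unique]).

    The two equations are matched by three facts about the Laplace transform.

    - L(Phi_a)(p) = p^(-a) on Re p > 0 ([laplace_Phi]). Put
      K_a(p) for the integral of t^(a-1) e^(-pt). Integration by parts gives
      a K_a = p K_(a+1), differentiation under the integral sign gives
      K_a' = - K_(a+1), so p^a K_a(p) has derivative zero along the positive
      reals and along every vertical line, and is equal to its value
      Gamma(a) at p = 1.
    - L(Phi_a * v) = p^(-a) L(v), by Fubini's theorem ([laplace_Phi_conv]). Here
      v is any function with an absolutely convergent Laplace integral, because
      this is all that is known outside [0, T] of the function v that comes
      with a solution on [0, T].
    - L is injective ([laplace_zero_continuous]), by Phragmen's argument: if
      the Laplace integral of w vanishes on the positive reals, then so does
      every term but the first one of
<<
        sum_n (-1)^n e^(npx) / n! L(w)(np) = int w(t) exp(- e^(p (x - t))) dt,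
>>
      so that the right-hand side does not depend on p; as p tends to infinity
      the double exponential tends to the indicator function of t > x, and w
      has integral zero on [0, x]. *)

(** * Lebesgue integrals of real functions *)

Section toolkit.
Context {R : realType}.
Notation mu := (@lebesgue_measure R).
Implicit Types (f g : R -> R) (D : set R).

(** Reflections are taken as the basic change of variables: they exchange the
    two forms of a convolution, and two of them make a translation. *)
Lemma lebesgue_measure_reflect (c : R) (A : set R) : measurable A ->
  pushforward mu ((fun x => (c - x)%R) : R -> measurableTypeR R) A = mu A.
Proof.
move=> mA; apply/esym/lebesgue_measure_unique; last by [].
  exact: measurable_funB.
move=> mc /= _ [[a b]] _ <-.
rewrite /pushforward /=.
rewrite (_ : _ @^-1` _ = `[c - b, c - a[%classic); last first.
  by apply/seteqP; split => x /=; rewrite !in_itv/= => /andP[? ?];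
    apply/andP; split; lra.
rewrite !lebesgue_measure_itv/= !lte_fin.
have -> : (c - b < c - a) = (a < b) by apply/idP/idP; lra.
by case: ifP => // _; rewrite -!EFinB; congr EFin; lra.
Qed.

Lemma ge0_integral_reflect (c : R) (f : R -> \bar R) :
  measurable_fun setT f -> (forall x, 0 <= f x)%E ->
  (\int[mu]_x f (c - x)%R = \int[mu]_x f x)%E.
Proof.
move=> mf f0.
transitivity (\int[pushforward mu ((fun x => (c - x)%R) : R -> measurableTypeR R)]_x f x)%E.
  by rewrite ge0_integral_pushforward//=; exact: measurable_funB.
apply: eq_measure_integral; first exact: measurable_funB.
by move=> mc A mA _; exact: lebesgue_measure_reflect.
Qed.

Lemma integrable_reflect (c : R) f :
  mu.-integrable setT (EFin \o f) ->
  mu.-integrable setT (EFin \o (fun x => f (c - x))).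
Proof.
move=> /integrableP[mf foo]; apply/integrableP; split.
  apply/measurable_EFinP; move/measurable_EFinP : mf => mf.
  by apply: measurableT_comp => //; exact: measurable_funB.
rewrite (ge0_integral_reflect c (f := fun x => `|(f x)%:E|%E))//.
exact: measurableT_comp.
Qed.

Lemma integral_reflect (c : R) f :
  mu.-integrable setT (EFin \o f) ->
  (\int[mu]_x (f (c - x))%:E = \int[mu]_x (f x)%:E)%E.
Proof.
move=> fi; have [mf foo] := integrableP _ _ _ fi.
have mc : measurable_fun setT ((fun x => c - x) : R -> measurableTypeR R).
  exact: measurable_funB.
transitivity (\int[pushforward mu ((fun x => (c - x)%R) : R -> measurableTypeR R)]_x (f x)%:E)%E.
  by rewrite integral_pushforward//=; exact: integrable_reflect.
apply: eq_measure_integral => A mA _; exact: lebesgue_measure_reflect.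
Qed.

Lemma Rintegral_dominated_cvg D (f_ : nat -> R -> R) f g :
  measurable D -> (forall n, measurable_fun D (f_ n)) -> measurable_fun D f ->
  {ae mu, forall x, D x -> f_ n x @[n --> \oo] --> f x} ->
  mu.-integrable D (EFin \o g) ->
  (forall n x, D x -> `|f_ n x| <= g x) ->
  mu.-integrable D (EFin \o f) /\
  (\int[mu]_(x in D) f_ n x) @[n --> \oo] --> \int[mu]_(x in D) f x.
Proof.
move=> mD mf_ mf cf ig fg.
have mF n : measurable_fun D (EFin \o f_ n) by exact/measurable_EFinP.
have mf' : measurable_fun D (EFin \o f) by exact/measurable_EFinP.
have cF : {ae mu, forall x, D x -> (EFin \o f_ n) x @[n --> \oo] --> (EFin \o f) x}.
  apply: (@filterS _ _ (ae_filter_ringOfSetsType mu)) cf => x /= h Dx; apply: cvg_EFin; first by apply: nearW.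
  exact: h.
have bF : {ae mu, forall x n, D x -> (`|(EFin \o f_ n) x| <= (EFin \o g) x)%E}.
  by apply: aeW => x n Dx /=; rewrite lee_fin; exact: fg.
have [fi _ cv] := @dominated_convergence _ _ _ mu D mD _ _ _ mF mf' cF ig bF; split=> //.
rewrite /Rintegral; apply: fine_cvg; rewrite fineK//.
exact: integrable_fin_num.
Qed.

Lemma integrable_le D f g : measurable D -> measurable_fun D f ->
  mu.-integrable D (EFin \o g) -> (forall x, D x -> `|f x| <= g x) ->
  mu.-integrable D (EFin \o f).
Proof.
move=> mD mf gi fg; apply: (@le_integrable _ _ _ mu D mD (EFin \o f) (EFin \o g)) => //; [|move=> x Dx].
  exact/measurable_EFinP.
rewrite /= lee_fin (le_trans (fg _ Dx))//.
by rewrite ler_norm.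
Qed.

Lemma integrable_cmul D (k : R) f : measurable D ->
  mu.-integrable D (EFin \o f) -> mu.-integrable D (EFin \o (fun t => k * f t)).
Proof.
move=> mD fi; rewrite (_ : EFin \o _ = (fun t => k%:E * (EFin \o f) t)%E).
  exact: integrableZl.
by apply/funext.
Qed.

Lemma integrable_add D f g : measurable D ->
  mu.-integrable D (EFin \o f) -> mu.-integrable D (EFin \o g) ->
  mu.-integrable D (EFin \o (fun t => f t + g t)).
Proof.
move=> mD fi gi; rewrite (_ : EFin \o _ = ((EFin \o f) \+ (EFin \o g))%E).
  exact: integrableD.
by apply/funext.
Qed.

Lemma integrable_sub D f g : measurable D ->
  mu.-integrable D (EFin \o f) -> mu.-integrable D (EFin \o g) ->
  mu.-integrable D (EFin \o (fun t => f t - g t)).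
Proof.
move=> mD fi gi; rewrite (_ : EFin \o _ = ((EFin \o f) \- (EFin \o g))%E).
  exact: integrableB.
by apply/funext.
Qed.

Lemma integrable_ext D f g : measurable D -> (forall t, D t -> f t = g t) ->
  mu.-integrable D (EFin \o f) -> mu.-integrable D (EFin \o g).
Proof.
move=> mD fg; apply: eq_integrable => // t; rewrite inE => Dt.
by rewrite /= fg.
Qed.

Lemma integrable_mono D E f : measurable D -> measurable E -> E `<=` D ->
  mu.-integrable D (EFin \o f) -> mu.-integrable E (EFin \o f).
Proof. by move=> mD mE ED; exact: integrableS. Qed.

Lemma integrable_patch D f : measurable D ->
  mu.-integrable D (EFin \o f) <-> mu.-integrable setT (EFin \o (f \_ D)).
Proof.
move=> mD; rewrite (_ : EFin \o (f \_ D) = (EFin \o f) \_ D).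
  by rewrite integrable_mkcond.
by rewrite restrict_EFin.
Qed.

Lemma integrable_measurable D f :
  mu.-integrable D (EFin \o f) -> measurable_fun D f.
Proof. by move=> fi; apply/measurable_EFinP; exact: measurable_int fi. Qed.

End toolkit.


(** * The fundamental theorem of calculus on the half-line *)

Section halfline_integrals.
Context {R : realType}.
Notation mu := (@lebesgue_measure R).
Implicit Types (f g h H : R -> R) (D : set R).

Lemma is_derive_continuous f (x df : R) : is_derive x (1 : R) f df -> {for x, continuous f}.
Proof.
by move=> [fx _]; apply: differentiable_continuous; exact/derivable1_diffP.
Qed.

Lemma integral_FTC_segment H h (a b : R) : a < b ->
  (forall x : R, a <= x <= b -> is_derive x (1 : R) H (h x)) ->
  (forall x : R, a <= x <= b -> {for x, continuous h}) ->
  (\int[mu]_(x in `[a, b]) (h x)%:E = (H b - H a)%:E)%E.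
Proof.
move=> ab dH ch; rewrite EFinB.
apply: continuous_FTC2 => //.
- apply/continuous_within_itvP => //; split.
  + by move=> x; rewrite in_itv/= => /andP[ax xb]; apply: ch; rewrite !ltW.
  + by apply: cvg_at_right_filter; apply: ch; rewrite lexx ltW.
  + by apply: cvg_at_left_filter; apply: ch; rewrite lexx ltW.
- split.
  + by move=> x; rewrite in_itv/= => /andP[ax xb];
      have [] : is_derive x (1 : R) H (h x) by apply: dH; rewrite !ltW.
  + apply: cvg_at_right_filter; apply: is_derive_continuous.
    by apply: dH; rewrite lexx ltW.
  + apply: cvg_at_left_filter; apply: is_derive_continuous.
    by apply: dH; rewrite lexx ltW.
- move=> x; rewrite in_itv/= => /andP[ax xb].
  by rewrite derive1E; apply: derive_val; apply: dH; rewrite !ltW.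
Qed.

(** Starting at n = 2 keeps the intervals [1/n, n] non-degenerate. *)
Let J n : set R := `[(n.+2%:R)^-1, n.+2%:R]%classic.

Lemma exhaust_lt n : (n.+2%:R : R)^-1 < n.+2%:R.
Proof.
rewrite -[ltLHS]mul1r ltr_pdivrMr// -natrM ltr1n.
by rewrite mulnS ltn_addr.
Qed.

Lemma exhaust_bigcup : \bigcup_n J n = `]0, +oo[%classic.
Proof.
apply/seteqP; split => x /=.
  move=> [n _]; rewrite /J/= !in_itv/= andbT => /andP[+ _].
  by apply: lt_le_trans; rewrite invr_gt0.
rewrite in_itv/= andbT => x0.
have [n nx] : exists n : nat, x^-1 + x < n%:R.
  exists (Num.truncn (x^-1 + x)).+1.
  by apply: truncnS_gt.
exists n => //; rewrite /J/= in_itv/=.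
have x'0 : 0 < x^-1 by rewrite invr_gt0.
have nn : n%:R <= n.+2%:R :> R by rewrite ler_nat ltnW.
apply/andP; split; last by lra.
by rewrite -[leRHS]invrK lef_pV2 ?posrE//; lra.
Qed.

Lemma exhaust_nd : nondecreasing_seq J.
Proof.
move=> m n mn; apply/subsetPset => x; rewrite /J/= !in_itv/= => /andP[h1 h2].
have mn' : m.+2%:R <= n.+2%:R :> R by rewrite ler_nat !ltnS.
rewrite (le_trans h2 mn') andbT (le_trans _ h1)//.
by rewrite lef_pV2 ?posrE.
Qed.

Lemma pos_continuous_measurable h : (forall x : R, 0 < x -> {for x, continuous h}) ->
  measurable_fun (`]0, +oo[%classic : set R) h.
Proof.
move=> ch; apply: open_continuous_measurable_fun; first exact: interval_open.
by move=> x; rewrite inE/= in_itv/= andbT; exact: ch.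
Qed.

(** The integrals over the compact intervals [1/n, n] are differences of two
    values of H, hence bounded by M. *)
Lemma integrable_bounded_primitive H h (M : R) :
  (forall x : R, 0 < x -> is_derive x (1 : R) H (h x)) ->
  (forall x : R, 0 < x -> {for x, continuous h}) ->
  (forall x : R, 0 < x -> 0 <= h x) ->
  (forall x : R, 0 < x -> 0 <= H x <= M) ->
  mu.-integrable `]0, +oo[ (EFin \o h).
Proof.
move=> dH ch h0 HM; have mh := pos_continuous_measurable ch.
apply/integrableP; split; first exact/measurable_EFinP.
have Jpos n x : J n x -> 0 < x.
  rewrite /J/= in_itv/= => /andP[+ _]; apply: lt_le_trans.
  by rewrite invr_gt0.
have mJ n : measurable_fun (J n) (fun x => `|(h x)%:E|%E).
  apply: measurableT_comp => //; apply/measurable_EFinP.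
  apply: (@measurable_funS _ _ _ _ (`]0, +oo[%classic : set R)) => //.
  by move=> x /Jpos; rewrite /= in_itv/= andbT.
have := @ge0_nondecreasing_set_cvg_integral _ (measurableTypeR R) _ J
  (fun x => `|(h x)%:E|%E) mu exhaust_nd (fun=> measurable_itv _) mJ
  (fun _ x _ => abse_ge0 _).
rewrite exhaust_bigcup => /cvg_lim <- //.
apply: (@le_lt_trans _ _ M%:E); last exact: ltry.
apply: lime_le.
  apply: ereal_nondecreasing_is_cvgn.
  apply: (@ge0_nondecreasing_set_nondecreasing_integral _ (measurableTypeR R) _ J) => //.
    exact: exhaust_nd.
  by move=> i; exact: measurable_itv.
apply: nearW => n.
rewrite [leLHS](_ : _ = (\int[mu]_(x in J n) (h x)%:E)%E); last first.
  apply: eq_integral => x; rewrite inE => /Jpos x0.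
  by rewrite /= ger0_norm// h0.
have -> : (\int[mu]_(x in J n) (h x)%:E = (H n.+2%:R - H (n.+2%:R)^-1)%:E)%E.
  apply: integral_FTC_segment (exhaust_lt n) _ _ => x xJ.
    by apply: dH; apply: (Jpos n); rewrite /J/= in_itv.
  by apply: ch; apply: (Jpos n); rewrite /J/= in_itv.
rewrite lee_fin.
have /andP[_ ?] := HM n.+2%:R (ltr0Sn _ _).
have /andP[? _] := HM (n.+2%:R)^-1 (ltac:(by rewrite invr_gt0)).
lra.
Qed.

(** Stated on the open half-line with limits at both ends, since it is applied
    to functions H such as t^a e^(-xt) with 0 < a < 1, whose derivative is
    unbounded near 0. *)
Lemma Rintegral_derive_halfline H h (l0 l1 : R) :
  (forall x : R, 0 < x -> is_derive x (1 : R) H (h x)) ->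
  (forall x : R, 0 < x -> {for x, continuous h}) ->
  mu.-integrable `]0, +oo[ (EFin \o h) ->
  H x @[x --> 0^'+] --> l0 -> H x @[x --> +oo] --> l1 ->
  \int[mu]_(x in `]0, +oo[) h x = l1 - l0.
Proof.
move=> dH ch ih H0 H1.
have Jpos n x : J n x -> 0 < x.
  rewrite /J/= in_itv/= => /andP[+ _]; apply: lt_le_trans.
  by rewrite invr_gt0.
have mh := pos_continuous_measurable ch.
have JD n : J n `<=` `]0, +oo[%classic.
  by move=> x /Jpos; rewrite /= in_itv/= andbT.
have mJ n : measurable (J n) by exact: measurable_itv.
have E n : \int[mu]_(x in `]0, +oo[) (h \_ (J n)) x = H n.+2%:R - H (n.+2%:R)^-1.
  rewrite -Rintegral_mkcondr (setIidr (JD n)).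
  have FTC : (\int[mu]_(x in J n) (h x)%:E = (H n.+2%:R - H (n.+2%:R)^-1)%:E)%E.
    apply: integral_FTC_segment (exhaust_lt n) _ _ => x xJ.
      by apply: dH; apply: (Jpos n); rewrite /J/= in_itv.
    by apply: ch; apply: (Jpos n); rewrite /J/= in_itv.
  by rewrite /Rintegral FTC.
have [_ cv] : mu.-integrable `]0, +oo[ (EFin \o h) /\
   \int[mu]_(x in `]0, +oo[) (h \_ (J n)) x @[n --> \oo] --> \int[mu]_(x in `]0, +oo[) h x.
  apply: (@Rintegral_dominated_cvg _ _ _ _ (fun x => `|h x|)) => //.
  - move=> n; apply/(measurable_restrict _ (mJ n) (measurable_itv _)).
    by apply: measurable_funS mh => //; exact: subIsetl.
  - apply: aeW => x x0; apply: cvg_near_cst.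
    move: x0; rewrite -exhaust_bigcup => -[N _ xN].
    exists N => // n /= Nn.
    rewrite patchE mem_set//.
    by have /subsetPset := exhaust_nd Nn; apply.
  - exact: integrable_norm.
  - move=> n x _; rewrite patchE; case: ifP => // _.
    by rewrite normr0.
rewrite (_ : (fun n => _) = (fun n => H n.+2%:R - H (n.+2%:R)^-1)) in cv; last first.
  by apply/funext.
have cinf : (n.+2%:R : R) @[n --> \oo] --> +oo.
  under eq_fun do rewrite -addn2.
  exact: (cvg_comp _ _ (cvg_addnr 2) cvgr_idn).
have cv' : H n.+2%:R - H (n.+2%:R)^-1 @[n --> \oo] --> l1 - l0.
  apply: cvgB; first exact: (cvg_comp _ _ cinf H1).
  apply: (cvg_comp _ _ _ H0).
  move=> A [e /= e0 eA].
  have /cvgr0Pnorm_lt /(_ e e0) [N _ hN] : ((n.+2%:R : R)^-1) @[n --> \oo] --> (0:R).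
    by apply/gtr0_cvgV0 => //; apply: nearW => n.
  exists N => // n Nn /=; apply: eA => /=; last by rewrite invr_gt0.
  by rewrite sub0r normrN; exact: hN.
exact: (cvg_unique _ cv cv').
Qed.

End halfline_integrals.


(** * The functions t^a e^(-xt) *)

Section power_exponential.
Context {R : realType}.
Notation mu := (@lebesgue_measure R).
Implicit Types (a x y t : R).

(** From ln u < u at u = (x / b) (1 + t), where the right-hand side becomes
    x (1 + t) after multiplication by b. *)
Lemma powR_expR_bounded b x : 0 < b -> 0 < x ->
  exists C : R, 0 < C /\ forall t, 0 < t -> (1 + t) `^ b * expR (- x * t) <= C.
Proof.
move=> b0 x0; exists (expR (x - b * ln (x / b))); split; first exact: expR_gt0.
move=> t t0.
have t1 : 0 < 1 + t by lra.
have xb : 0 < x / b by rewrite divr_gt0.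
rewrite /powR gt_eqF// -expRD ler_expR.
have h : ln (x / b * (1 + t)) < x / b * (1 + t).
  by rewrite ln_sublinear// mulr_gt0.
have {}h : b * ln (x / b * (1 + t)) <= b * (x / b * (1 + t)).
  by rewrite ler_pM2l// ltW.
rewrite lnM ?posrE// in h.
rewrite (_ : b * (x / b * (1 + t)) = x * (1 + t)) in h; last by field; lra.
lra.
Qed.

Lemma powR_expR_is_derive a x t : 0 < t ->
  is_derive t (1 : R) (fun t => t `^ a * expR (- x * t))
    (a * (t `^ (a - 1) * expR (- x * t)) - x * (t `^ a * expR (- x * t))).
Proof.
move=> t0.
have h1 := is_derive1_powR a t0.
apply: is_derive_eq.
rewrite /GRing.scale/=; ring.
Qed.

Lemma powR_expR_continuous a x t : 0 < t ->
  {for t, continuous (fun t => t `^ a * expR (- x * t))}.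
Proof.
by move=> t0; apply: is_derive_continuous; exact: powR_expR_is_derive.
Qed.

(** Both ends are dealt with at once by comparison with the derivative h of the
    bounded function (t / (1 + t))^a: it is a t^(a-1) (1 + t)^(-a-1), and
    (1 + t)^(a+1) e^(-xt) is bounded. *)
Lemma integrable_powR_expR a x : 0 < a -> 0 < x ->
  mu.-integrable `]0, +oo[ (EFin \o (fun t => t `^ (a - 1) * expR (- x * t))).
Proof.
move=> a0 x0.
have a1 : 0 < a + 1 by lra.
have [C [C0 HC]] := powR_expR_bounded a1 x0.
pose H t := (t / (1 + t)) `^ a.
pose h t := a * ((t / (1 + t)) `^ (a - 1) * (1 + t) ^- 2).
have u0 t : 0 < t -> 0 < t / (1 + t) by move=> t0; rewrite divr_gt0//; lra.
have du t : 0 < t -> is_derive t (1 : R) (fun t => t / (1 + t)) ((1 + t) ^- 2).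
  move=> t0; have t1 : 1 + t != 0 by lra.
  have d1 : is_derive t (1 : R) (fun t => 1 + t) 1.
    by apply: is_derive_eq; ring.
  have dV := @is_deriveV _ (fun t => 1 + t) t 1 1 t1 d1.
  apply: is_derive_eq.
  rewrite /GRing.scale/=; field; lra.
have ih : mu.-integrable `]0, +oo[ (EFin \o h).
  apply: (@integrable_bounded_primitive _ H h 1).
  - move=> t t0; have := u0 _ t0 => ut0.
    have d1 := is_derive1_powR a ut0; have d2 := du _ t0.
    have := @is_derive1_comp _ (fun u => u `^ a) (fun t => t / (1 + t)) t _ _ d1 d2.
    by rewrite /H /h mulrA.
  - move=> t t0; have := u0 _ t0 => ut0.
    have d1 := is_derive1_powR (a - 1) ut0; have d2 := du _ t0.
    have c1 := is_derive_continuous (@is_derive1_comp _ (fun u => u `^ (a - 1)) (fun t => t / (1 + t)) t _ _ d1 d2).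
    rewrite /h; apply: cvgM; first exact: cvg_cst.
    apply: cvgM; first exact: c1.
    apply: cvgV; first by rewrite expf_neq0//; lra.
    apply: (@continuous_comp _ _ _ (fun t => 1 + t) (fun u => u ^+ 2)).
      by apply: cvgD; [exact: cvg_cst|exact: cvg_id].
    exact: exprn_continuous.
  - move=> t t0; rewrite /h mulr_ge0 ?ltW// mulr_gt0 ?powR_gt0 ?u0//.
    by rewrite invr_gt0 exprn_gt0//; lra.
  - move=> t t0; rewrite /H powR_ge0/=.
    have p1 : 1 `^ a = 1 :> R by rewrite powR1.
    rewrite -[leRHS]p1; apply: ge0_ler_powR; rewrite ?nnegrE ?ltW ?u0//.
    by rewrite ltr_pdivrMr; lra.
apply: (@integrable_le _ _ _ (fun t => C / a * h t)) => //.
- apply: pos_continuous_measurable => t t0; exact: powR_expR_continuous.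
- exact: integrable_cmul.
move=> t /=; rewrite in_itv/= andbT => t0.
rewrite ger0_norm; last by rewrite mulr_ge0 ?powR_ge0 ?expR_ge0.
have t1 : 0 < 1 + t by lra.
rewrite /h powRM ?invr_ge0; [|lra|lra].
rewrite -(@powR_inv1 _ (1 + t)); last lra.
rewrite -powRrM.
have -> : (1 + t) ^- 2 = (1 + t) `^ (- 2%:R) by rewrite powR_invn//; lra.
rewrite -[X in _ <= _ * (_ * X)]mulrA -powRD; last by apply/implyP => _; lra.
rewrite (_ : -1 * (a - 1) + - 2%:R = - (a + 1)); last by ring.
rewrite powRN.
rewrite (_ : C / a * _ = t `^ (a - 1) * (C / (1 + t) `^ (a + 1))); last first.
  by field; rewrite !gt_eqF// powR_gt0.
by rewrite ler_wpM2l ?powR_ge0// ler_pdivlMr ?powR_gt0// mulrC HC.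
Qed.

End power_exponential.


(** * Mellin-Laplace integrals of oscillating functions *)

Section oscillating.
Context {R : realType}.
Notation mu := (@lebesgue_measure R).
Implicit Types (a x y t : R) (g : R -> R).

(** Differentiation under the integral sign, in the form of [is_derive], which
    the automatic computation of derivatives can use. *)
Lemma is_derive_Rintegral (D : set R) (f df : R -> R -> R) (G : R -> R) (s u v : R) :
  measurable D -> u < s < v ->
  (forall r, u < r < v -> mu.-integrable D (EFin \o f r)) ->
  (forall r t, u < r < v -> D t -> is_derive r (1 : R) (f ^~ t) (df r t)) ->
  (forall t, 0 <= G t) ->
  mu.-integrable D (EFin \o G) ->
  (forall r t, u < r < v -> D t -> `|df r t| <= G t) ->
  is_derive s (1 : R) (fun r => \int[mu]_(t in D) f r t) (\int[mu]_(t in D) df s t).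
Proof.
move=> mD sI fi dfi G0 Gi dG.
have Is : `]u, v[%classic s by rewrite /= in_itv.
have fi' r : `]u, v[%classic r -> mu.-integrable D (EFin \o f r).
  by rewrite /= in_itv; exact: fi.
have der r t : `]u, v[%classic r -> D t -> derivable (f ^~ t) r 1.
  by rewrite /= in_itv => rI Dt; have [] := dfi _ _ rI Dt.
have pE r t : `]u, v[%classic r -> D t -> partial1of2 f r t = df r t.
  by rewrite /= in_itv => rI Dt; rewrite partial1of2E; have [] := dfi _ _ rI Dt.
have ub r t : `]u, v[%classic r -> D t -> `|partial1of2 f r t| <= G t.
  by move=> rI Dt; rewrite pE// dG//; move: rI; rewrite /= in_itv.
have dd := @derivable_under_integral _ _ _ mu f D mD s u v Is fi' der G G0 Gi ub.
have de := @differentiation_under_integral _ _ _ mu f D mD s u v Is fi' der G G0 Gi ub.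
split; first exact: dd.
rewrite -derive1E de; apply: eq_Rintegral => t tD.
by apply: pE => //; move: tD; rewrite inE.
Qed.

(** For g = cos and g = - sin these are the real and imaginary parts of
    Gamma(a + 1) p^(-a-1) at p = x + i y. *)
Definition wave_int g a x y : R :=
  \int[mu]_(t in `]0, +oo[) (t `^ a * expR (- x * t) * g (y * t)).

Variable (g g' : R -> R).
Hypothesis dg : forall u : R, is_derive u (1 : R) g (g' u).
Hypothesis cg' : continuous g'.
Hypothesis g1 : forall u, `|g u| <= 1.
Hypothesis g'1 : forall u, `|g' u| <= 1.

Lemma wave_continuous (h : R -> R) a x y t : continuous h -> 0 < t ->
  {for t, continuous (fun t => t `^ a * expR (- x * t) * h (y * t))}.
Proof.
move=> ch t0; apply: cvgM; first exact: powR_expR_continuous.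
by apply: (@continuous_comp _ _ _ (fun t => y * t) h); [exact: mulrl_continuous|exact: ch].
Qed.

Lemma wave_integrable (h : R -> R) a x y : continuous h ->
  (forall u, `|h u| <= 1) -> -1 < a -> 0 < x ->
  mu.-integrable `]0, +oo[
    (EFin \o (fun t => t `^ a * expR (- x * t) * h (y * t))).
Proof.
move=> ch h1 a1 x0.
have a0 : 0 < a + 1 by lra.
have ii := integrable_powR_expR a0 x0; rewrite addrK in ii.
apply: (integrable_le _ _ ii) => //.
  by apply: pos_continuous_measurable => t t0; exact: wave_continuous.
move=> t _; rewrite normrM ger0_norm; last by rewrite mulr_ge0 ?powR_ge0 ?expR_ge0.
by rewrite ler_piMr// mulr_ge0 ?powR_ge0 ?expR_ge0.
Qed.

Let cg : continuous g. Proof. by move=> u; exact: is_derive_continuous. Qed.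

(** The derivative of t^a e^(-xt) g(yt), which vanishes at 0 and at infinity,
    has integral zero. *)
Lemma wave_int_by_parts a x y : 0 < a -> 0 < x ->
  a * wave_int g (a - 1) x y = x * wave_int g a x y - y * wave_int g' a x y.
Proof.
move=> a0 x0.
have i0 := wave_integrable y cg g1 (ltac:(lra) : -1 < a - 1) x0.
have i1 := wave_integrable y cg g1 (ltac:(lra) : -1 < a) x0.
have i2 := wave_integrable y cg' g'1 (ltac:(lra) : -1 < a) x0.
pose H t := t `^ a * expR (- x * t) * g (y * t).
pose h t := a * (t `^ (a - 1) * expR (- x * t) * g (y * t)) -
  x * (t `^ a * expR (- x * t) * g (y * t)) +
  y * (t `^ a * expR (- x * t) * g' (y * t)).
have ih : mu.-integrable `]0, +oo[ (EFin \o h).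
  rewrite /h; apply: integrable_add => //; last exact: integrable_cmul.
  by apply: integrable_sub => //; exact: integrable_cmul.
have E : \int[mu]_(t in `]0, +oo[) h t = 0 - 0.
  apply: (@Rintegral_derive_halfline _ H h) => //.
  - move=> t t0; rewrite /H /h.
    have d1 := powR_expR_is_derive a x t0.
    have d2 : is_derive t (1 : R) (fun t => y * t) y.
      by apply: is_derive_eq; rewrite /GRing.scale/=; ring.
    have d3 := @is_derive1_comp _ g (fun t => y * t) t _ _ (dg _) d2.
    apply: is_derive_eq; rewrite /GRing.scale/=; ring.
  - move=> t t0; rewrite /h; apply: cvgD; first apply: cvgB.
    + by apply: cvgM; [exact: cvg_cst|exact: wave_continuous].
    + by apply: cvgM; [exact: cvg_cst|exact: wave_continuous].
    + by apply: cvgM; [exact: cvg_cst|exact: wave_continuous].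
  - apply/norm_cvg0P; apply: (@squeeze_cvgr _ _ _ _ (cst 0) (fun t => t `^ a)).
    + near=> t; rewrite normr_ge0/= /H normrM ger0_norm; last first.
        by rewrite mulr_ge0 ?powR_ge0 ?expR_ge0.
      have t0 : 0 < t by [].
      rewrite -[leRHS]mulr1 ler_pM ?normr_ge0 ?mulr_ge0 ?powR_ge0 ?expR_ge0//.
      rewrite -[leRHS]mulr1 ler_wpM2l ?powR_ge0// -expR0 ler_expR mulNr.
      by rewrite oppr_le0 mulr_ge0// ltW.
    + exact: cvg_cst.
    + exact: powR_cvg0.
  - have a1 : 0 < a + 1 by lra.
    have [C [C0 HC]] := powR_expR_bounded a1 x0.
    apply/norm_cvg0P; apply: (@squeeze_cvgr _ _ _ _ (cst 0) (fun t => C * t^-1)).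
    + near=> t; rewrite normr_ge0/= /H normrM ger0_norm; last first.
        by rewrite mulr_ge0 ?powR_ge0 ?expR_ge0.
      have t0 : 0 < t by [].
      apply: (@le_trans _ _ (t `^ a * expR (- x * t))).
        by rewrite ler_piMr ?mulr_ge0 ?powR_ge0 ?expR_ge0.
      rewrite ler_pdivlMr// (le_trans _ (HC _ t0))//.
      rewrite mulrAC ler_wpM2r ?expR_ge0// mulrC.
      have -> : t * t `^ a = t `^ (a + 1).
        by rewrite powRD ?powRr1 ?ltW 1?mulrC//; apply/implyP => _; rewrite gt_eqF.
      by rewrite ge0_ler_powR ?nnegrE//; lra.
    + exact: cvg_cst.
    + rewrite -[X in _ --> X](mulr0 C); apply: cvgM; first exact: cvg_cst.
      by apply/gtr0_cvgV0 => //; near=> t.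
have {}E : a * wave_int g (a - 1) x y - x * wave_int g a x y + y * wave_int g' a x y = 0.
  rewrite -[RHS](subrr 0) -E /h RintegralD//; [|by apply: integrable_sub => //; exact: integrable_cmul|exact: integrable_cmul].
  rewrite RintegralB//; [|exact: integrable_cmul..].
  by rewrite !RintegralZl.
lra.
Unshelve. all: end_near. Qed.

Lemma wave_int_is_derive_y a x y : -1 < a -> 0 < x ->
  is_derive y (1 : R) (wave_int g a x) (wave_int g' (a + 1) x y).
Proof.
move=> a1 x0.
have a2 : 0 < a + 1 + 1 by lra.
have ii := integrable_powR_expR a2 x0; rewrite addrK in ii.
have -> : wave_int g' (a + 1) x y = \int[mu]_(t in `]0, +oo[)
   (t `^ a * expR (- x * t) * (t * g' (y * t))).
  apply: eq_Rintegral => t; rewrite inE/= in_itv/= andbT => t0.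
  by rewrite powRD ?powRr1 ?ltW//; [ring|apply/implyP => _; rewrite gt_eqF].
apply: (@is_derive_Rintegral `]0, +oo[%classic
  (fun y t => t `^ a * expR (- x * t) * g (y * t))
  (fun y t => t `^ a * expR (- x * t) * (t * g' (y * t)))
  (fun t => t `^ (a + 1) * expR (- x * t)) y (y - 1) (y + 1)) => //.
- by apply/andP; split; lra.
- by move=> r _; exact: wave_integrable.
- move=> r t _ t0.
  have d2 : is_derive r (1 : R) (fun r => r * t) t.
    by apply: is_derive_eq; rewrite /GRing.scale/=; ring.
  have d3 := @is_derive1_comp _ g (fun r => r * t) r _ _ (dg _) d2.
  by apply: is_derive_eq; rewrite /GRing.scale/=; ring.
- by move=> t; rewrite mulr_ge0 ?powR_ge0 ?expR_ge0.
- move=> r t _; rewrite /= in_itv/= andbT => t0.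
  rewrite !normrM (ger0_norm (powR_ge0 _ _)) (ger0_norm (expR_ge0 _)).
  rewrite (gtr0_norm t0).
  rewrite powRD; last by apply/implyP => _; rewrite gt_eqF.
  rewrite powRr1 ?(ltW t0)// -!mulrA ler_wpM2l ?powR_ge0//.
  rewrite [leRHS]mulrC ler_wpM2l ?expR_ge0// ler_piMr// ltW//.
Qed.

Lemma wave_int_is_derive_x a x y : -1 < a -> 0 < x ->
  is_derive x (1 : R) (fun x => wave_int g a x y) (- wave_int g (a + 1) x y).
Proof.
move=> a1 x0.
have a2 : 0 < a + 1 + 1 by lra.
have x2 : 0 < x / 2 by lra.
have ii := integrable_powR_expR a2 x2; rewrite addrK in ii.
have -> : - wave_int g (a + 1) x y = \int[mu]_(t in `]0, +oo[)
   (t `^ a * (- t * expR (- x * t)) * g (y * t)).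
  rewrite -mulN1r -RintegralZl//; last by apply: wave_integrable => //; lra.
  apply: eq_Rintegral => t; rewrite inE/= in_itv/= andbT => t0.
  by rewrite powRD ?powRr1 ?ltW//; [ring|apply/implyP => _; rewrite gt_eqF].
apply: (@is_derive_Rintegral `]0, +oo[%classic (fun x t => t `^ a * expR (- x * t) * g (y * t))
  (fun x t => t `^ a * (- t * expR (- x * t)) * g (y * t))
  (fun t => t `^ (a + 1) * expR (- (x / 2) * t)) x (x / 2) (x + 1)) => //.
- by apply/andP; split; lra.
- by move=> r /andP[? _]; apply: wave_integrable => //; lra.
- move=> r t _ t0.
  by apply: is_derive_eq; rewrite /GRing.scale/=; ring.
- by move=> t; rewrite mulr_ge0 ?powR_ge0 ?expR_ge0.
- move=> r t /andP[xr _]; rewrite /= in_itv/= andbT => t0.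
  rewrite !normrM (ger0_norm (powR_ge0 _ _)) (ger0_norm (expR_ge0 _)).
  rewrite normrN (gtr0_norm t0).
  rewrite powRD; last by apply/implyP => _; rewrite gt_eqF.
  rewrite powRr1 ?(ltW t0)// -!mulrA ler_wpM2l ?powR_ge0// ler_wpM2l ?(ltW t0)//.
  rewrite -[leRHS]mulr1 ler_pM ?expR_ge0 ?normr_ge0// ler_expR.
  by rewrite ler_wpM2r ?(ltW t0)// lerN2 ltW.
Qed.

End oscillating.


(** * The Gamma integral with a complex parameter *)

Section gamma.
Context {R : realType}.
Notation mu := (@lebesgue_measure R).
Implicit Types (a x y t : R) (g : R -> R).

Let dNsin (u : R) : is_derive u (1 : R) cos (- sin u) := is_derive_cos u.
Let cNsin : continuous (fun u : R => - sin u).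
Proof. by move=> u; apply: cvgN; exact: continuous_sin. Qed.
Let ccos : continuous (@cos R). Proof. exact: continuous_cos. Qed.
Let csin : continuous (@sin R). Proof. exact: continuous_sin. Qed.
Let cos1 (u : R) : `|cos u| <= 1. Proof. exact: cos_max. Qed.
Let sin1 (u : R) : `|sin u| <= 1. Proof. exact: sin_max. Qed.
Let Nsin1 (u : R) : `|- sin u| <= 1. Proof. by rewrite normrN. Qed.

Lemma wave_intN g a x y : continuous g -> (forall u, `|g u| <= 1) ->
  -1 < a -> 0 < x ->
  wave_int (fun u => - g u) a x y = - wave_int g a x y.
Proof.
move=> cg g1 a1 x0; rewrite -[RHS]mulN1r -RintegralZl//.
  by apply: eq_Rintegral => t _; rewrite mulN1r mulrN.
exact: wave_integrable.
Qed.

(** With the next lemma, the real and imaginary parts of a K_a = p K_(a+1). *)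
Lemma cos_int_by_parts a x y : 0 < a -> 0 < x ->
  a * wave_int cos (a - 1) x y = x * wave_int cos a x y + y * wave_int sin a x y.
Proof.
move=> a0 x0; rewrite (wave_int_by_parts dNsin cNsin cos1 Nsin1)//.
by rewrite wave_intN//; [ring|lra].
Qed.

Lemma sin_int_by_parts a x y : 0 < a -> 0 < x ->
  a * wave_int sin (a - 1) x y = x * wave_int sin a x y - y * wave_int cos a x y.
Proof.
by move=> a0 x0; rewrite (wave_int_by_parts (@is_derive_sin R) ccos sin1 cos1).
Qed.

Lemma cos_int_is_derive a x y : 0 < a -> 0 < x ->
  is_derive y (1 : R) (wave_int cos (a - 1) x) (- wave_int sin a x y).
Proof.
move=> a0 x0.
have := @wave_int_is_derive_y R _ _ dNsin cos1 Nsin1 (a - 1) x y.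
by rewrite subrK wave_intN//; [|lra]; apply=> //; lra.
Qed.

Lemma sin_int_is_derive a x y : 0 < a -> 0 < x ->
  is_derive y (1 : R) (wave_int sin (a - 1) x) (wave_int cos a x y).
Proof.
move=> a0 x0.
have := @wave_int_is_derive_y R _ _ (@is_derive_sin R) sin1 cos1 (a - 1) x y.
by rewrite subrK; apply=> //; lra.
Qed.

Lemma Gamma_intE a : Gamma_int a = wave_int cos (a - 1) 1 0.
Proof.
by apply: eq_Rintegral => t _; rewrite mul0r cos0 mulr1 mulN1r.
Qed.

(** In the variable r = ln x the function x^a K_a(x) is defined on the whole
    line, where a function with zero derivative is constant. *)
Lemma cos_int_real a x : 0 < a -> 0 < x ->
  expR (a * ln x) * wave_int cos (a - 1) x 0 = Gamma_int a.
Proof.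
move=> a0 x0.
pose W r := expR (a * r) * wave_int cos (a - 1) (expR r) 0.
have dW r : is_derive r (1 : R) W 0.
  have er : 0 < expR r by exact: expR_gt0.
  have d1 := @wave_int_is_derive_x R _ _ dNsin cos1 (a - 1) _ 0
    (ltac:(lra)) er.
  have d2 := @is_derive1_comp _ (fun x => wave_int cos (a - 1) x 0) expR r _ _ d1 (is_derive_expR r).
  have d3 : is_derive r (1 : R) (fun r => a * r) a.
    by apply: is_derive_eq; rewrite /GRing.scale/=; ring.
  have d4 := @is_derive1_comp _ expR (fun r => a * r) r _ _ (is_derive_expR _) d3.
  rewrite /W; apply: is_derive_eq; rewrite /GRing.scale/= subrK.
  have := cos_int_by_parts 0 a0 er; rewrite mul0r addr0 => E.
  have -> : wave_int cos (a - 1) (expR r) 0 = a^-1 * (expR r * wave_int cos a (expR r) 0).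
    by rewrite -E mulKf// gt_eqF.
  by field; rewrite gt_eqF.
have := is_derive_0_is_cst (ln x) 0 dW.
by rewrite /W lnK ?posrE// mulr0 expR0 mul1r Gamma_intE.
Qed.

Let wave_sin0 a x : wave_int sin a x 0 = 0.
Proof.
rewrite /wave_int (@eq_Rintegral _ _ _ _ _ (cst 0)); last first.
  by move=> t _; rewrite mul0r sin0 mulr0.
by rewrite Rintegral_cst// mul0r.
Qed.

(** The real and imaginary parts of p^a K_a(p) = Gamma(a) for p = x + i y, where
    P and th are the modulus and the argument of p^a. Along the vertical line
    through x the logarithmic derivatives of p^a and of K_a cancel, so both
    parts keep their value at y = 0. *)
Lemma wave_int_polar a x y : 0 < a -> 0 < x ->
  let P := expR (a / 2 * ln (x ^+ 2 + y ^+ 2)) in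
  let th := a * atan (y / x) in
  P * (wave_int cos (a - 1) x y * cos th + wave_int sin (a - 1) x y * sin th) = Gamma_int a
  /\ P * (wave_int cos (a - 1) x y * sin th - wave_int sin (a - 1) x y * cos th) = 0.
Proof.
move=> a0 x0 P th.
have x2 : 0 < x ^+ 2 by rewrite exprn_gt0.
have r0 z : 0 < x ^+ 2 + z ^+ 2 by rewrite ltr_pwDl ?sqr_ge0.
pose Q z := expR (a / 2 * ln (x ^+ 2 + z ^+ 2)).
pose T z := a * atan (z / x).
have dQ z : is_derive z (1 : R) Q (a * z / (x ^+ 2 + z ^+ 2) * Q z).
  have d1 : is_derive z (1 : R) (fun z => x ^+ 2 + z ^+ 2) (2 * z).
    by apply: is_derive_eq; rewrite /GRing.scale/=; ring.
  have d2 := @is_derive1_comp _ (@ln R) (fun z => x ^+ 2 + z ^+ 2) z _ _ (is_derive1_ln (r0 z)) d1.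
  have d3 : is_derive z (1 : R) (fun z => a / 2 * ln (x ^+ 2 + z ^+ 2)) (a * z / (x ^+ 2 + z ^+ 2)).
    by apply: is_derive_eq; rewrite /GRing.scale/=; field; rewrite gt_eqF.
  rewrite [_ * Q z]mulrC.
  exact: (@is_derive1_comp _ expR _ z _ _ (is_derive_expR _) d3).
have dT z : is_derive z (1 : R) T (a * x / (x ^+ 2 + z ^+ 2)).
  have d1 : is_derive z (1 : R) (fun z => z / x) (x^-1).
    by apply: is_derive_eq; rewrite /GRing.scale/=; ring.
  have d2 := @is_derive1_comp _ (@atan R) (fun z => z / x) z _ _ (is_derive1_atan _) d1.
  rewrite /T; apply: is_derive_eq; rewrite /GRing.scale/=; field.
  by rewrite gt_eqF//= gt_eqF// r0.
have dc z := @is_derive1_comp _ cos T z _ _ (is_derive_cos _) (dT z).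
have ds z := @is_derive1_comp _ sin T z _ _ (is_derive_sin _) (dT z).
have Kc z : wave_int cos (a - 1) x z =
    a^-1 * (x * wave_int cos a x z + z * wave_int sin a x z).
  by rewrite -cos_int_by_parts// mulKf// gt_eqF.
have Ks z : wave_int sin (a - 1) x z =
    a^-1 * (x * wave_int sin a x z - z * wave_int cos a x z).
  by rewrite -sin_int_by_parts// mulKf// gt_eqF.
have dU z : is_derive z (1 : R) (fun z => Q z * (wave_int cos (a - 1) x z * cos (T z) +
   wave_int sin (a - 1) x z * sin (T z))) 0.
  have dQz := dQ z; have dcz := dc z; have dsz := ds z.
  have dKc := cos_int_is_derive z a0 x0.
  have dKs := sin_int_is_derive z a0 x0.
  apply: is_derive_eq; rewrite /GRing.scale/=.
  rewrite Kc Ks; field; rewrite gt_eqF//= gt_eqF// r0.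
have dV z : is_derive z (1 : R) (fun z => Q z * (wave_int cos (a - 1) x z * sin (T z) -
   wave_int sin (a - 1) x z * cos (T z))) 0.
  have dQz := dQ z; have dcz := dc z; have dsz := ds z.
  have dKc := cos_int_is_derive z a0 x0.
  have dKs := sin_int_is_derive z a0 x0.
  apply: is_derive_eq; rewrite /GRing.scale/=.
  rewrite Kc Ks; field; rewrite gt_eqF//= gt_eqF// r0.
have T0 : T 0 = 0 by rewrite /T mul0r atan0 mulr0.
have Q0 : Q 0 = expR (a * ln x).
  by rewrite /Q expr0n/= addr0 lnXn// -[_ *+ 2]mulr_natl; congr expR; field.
split.
- have := is_derive_0_is_cst y 0 dU => /= ->.
  by rewrite T0 Q0 cos0 sin0 wave_sin0 mulr1 mulr0 addr0 cos_int_real.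
- have := is_derive_0_is_cst y 0 dV => /= ->.
  by rewrite T0 Q0 cos0 sin0 wave_sin0; ring.
Qed.

(** Otherwise the positive integrand would vanish almost everywhere on a set of
    infinite measure. *)
Lemma Gamma_int_gt0 a : 0 < a -> 0 < Gamma_int a.
Proof.
move=> a0.
have i := integrable_powR_expR a0 ltr01.
have E : Gamma_int a = \int[mu]_(t in `]0, +oo[) (t `^ (a - 1) * expR (- 1 * t)).
  by apply: eq_Rintegral => t _; rewrite mulN1r.
rewrite lt_neqAle; apply/andP; split; last first.
  by rewrite E; apply: Rintegral_ge0 => t _; rewrite mulr_ge0 ?powR_ge0 ?expR_ge0.
apply/negP => /eqP G0.
pose F (t : R) := t `^ (a - 1) * expR (- 1 * t).
have mf : measurable_fun (`]0, +oo[%classic : set R) (EFin \o F).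
  exact: measurable_int i.
have /(ae_eq_integral_abs mu (measurable_itv _) mf) :
    (\int[mu]_(t in `]0%R, +oo[) `|(EFin \o F) t|%E = 0)%E.
  have -> : (0%E : \bar R) = (Gamma_int a)%:E by rewrite -G0.
  rewrite E /Rintegral fineK; last first.
    by apply: integrable_fin_num.
  apply: eq_integral => t _ /=.
  by rewrite ger0_norm// mulr_ge0 ?powR_ge0 ?expR_ge0.
move=> [N [mN N0 NE]].
have sub : (`]0, +oo[%classic : set R) `<=` N.
  move=> t /= tD; apply: NE => /= /(_ tD)/=; rewrite in_itv/= andbT in tD.
  move=> /eqP; rewrite eqe mulf_eq0 => /orP[|]; apply/negP; rewrite gt_eqF//.
    exact: powR_gt0.
  exact: expR_gt0.
have : (mu `]0%R, +oo[ <= mu N)%E.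
  by apply: le_measure; rewrite ?inE//; exact: measurable_itv.
by rewrite lebesgue_measure_itv N0/= ltry oppr0 addye// leye_eq.
Qed.

End gamma.


(** * The Laplace transform of Phi *)

Section Phi_laplace.
Context {R : realType}.
Notation mu := (@lebesgue_measure R).
Implicit Types (a x y t : R) (b g : R -> R).

Lemma Gamma_Euler a : 0 < a -> Gamma a = Gamma_int a.
Proof. by move=> a0; rewrite /Gamma a0 big_ord0 addr0 divr1. Qed.

Lemma Gamma_gt0 a : 0 < a -> 0 < Gamma a.
Proof. by move=> a0; rewrite Gamma_Euler// Gamma_int_gt0. Qed.

(** The continuation of Gamma to -1/4 takes one step:
    Gamma(-1/4) = Gamma(3/4) / (-1/4). *)
Lemma c1_gt0 : 0 < c1 :> R.
Proof.
rewrite /c1 normr_gt0 /Gamma.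
have -> : (0 < - (1 / 4) :> R) = false by apply/negbTE; rewrite -leNgt; lra.
have -> : Num.truncn (- - (1 / 4) : R) = 0%N.
  by apply/eqP; rewrite truncn_eq; [|lra]; apply/andP; split; lra.
rewrite big_ord_recl big_ord0 mulr1/= addr0.
rewrite mulf_eq0 invr_eq0 negb_or; apply/andP; split; last by rewrite oppr_eq0 mulf_neq0// invr_eq0 pnatr_eq0.
by rewrite gt_eqF// Gamma_int_gt0//; lra.
Qed.

Lemma Phi_neg a t : t < 0 -> Phi a t = 0.
Proof. by move=> t0; rewrite /Phi leNgt t0. Qed.

Lemma Phi_ge0 a t : 0 < a -> 0 <= Phi a t.
Proof.
move=> a0; rewrite /Phi; case: ifP => // _.
by rewrite divr_ge0 ?powR_ge0// ltW// Gamma_gt0.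
Qed.

Lemma Phi_pos a t : 0 < t -> Phi a t = (Gamma a)^-1 * t `^ (a - 1).
Proof. by move=> t0; rewrite /Phi ltW// mulrC. Qed.

Lemma measurable_Phi a : measurable_fun setT (Phi a).
Proof.
apply: measurable_fun_ifT => //.
- exact: measurable_fun_ler.
- exact: measurable_funM.
Qed.

Lemma Phi_expR_integrable a x : 0 < a -> 0 < x ->
  mu.-integrable setT (EFin \o (fun t => Phi a t * expR (- x * t))).
Proof.
move=> a0 x0.
have i0 : mu.-integrable `]0, +oo[ (EFin \o (fun t => Phi a t * expR (- x * t))).
  have i := integrable_powR_expR a0 x0.
  apply: (@integrable_ext _ _ (fun t => (Gamma a)^-1 * (t `^ (a - 1) * expR (- x * t)))) => //.
    move=> t; rewrite /= in_itv/= andbT => t0.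
    by rewrite Phi_pos// mulrA.
  exact: integrable_cmul.
have i1 : mu.-integrable `[0, +oo[ (EFin \o (fun t => Phi a t * expR (- x * t))).
  apply/integrableP; split.
    apply/measurable_EFinP; apply: measurable_funTS.
    apply: measurable_funM; first exact: measurable_Phi.
    by apply: measurableT_comp => //; exact: mulrl_measurable.
  have [m l] := integrableP _ _ _ i0.
  rewrite -integral_itv_obnd_cbnd//.
  exact: measurableT_comp.
move: i1; rewrite integrable_mkcond//.
apply: eq_integrable => // t _; rewrite /patch; case: ifPn => //.
rewrite notin_setE/= in_itv/= andbT => /negP; rewrite -ltNge => t0.
by rewrite Phi_neg// mul0r.
Qed.

(** For g = cos and g = - sin, the real and imaginary parts of L(b)(x + i y). *)
Definition laplace_part g b x y : R :=
  \int[mu]_(t in `[0, +oo[) (expR (- x * t) * g (y * t) * b t).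

Lemma laplace_part_integrable g b x y : continuous g -> (forall u, `|g u| <= 1) ->
  laplace_integrable x b ->
  mu.-integrable `[0, +oo[ (EFin \o (fun t => expR (- x * t) * g (y * t) * b t)).
Proof.
move=> cg g1 ib.
have mb : measurable_fun (`[0, +oo[%classic : set R) (fun t => expR (- x * t) * b t).
  by apply/measurable_EFinP; exact: measurable_int ib.
apply: (@integrable_le _ _ _ (fun t => `|expR (- x * t) * b t|)) => //.
- rewrite (_ : (fun t => _) = (fun t => g (y * t) * (expR (- x * t) * b t))).
    apply: measurable_funM => //; apply: measurable_funTS.
    apply: (@measurableT_comp _ _ _ _ _ _ g).
      exact: continuous_measurable_fun.
    exact: mulrl_measurable.
  by apply/funext => t; ring.
- exact: integrable_norm.
move=> t _; rewrite mulrAC normrM ler_piMr//.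
Qed.

Lemma laplace_integrableS s x b : s <= x -> laplace_integrable s b -> laplace_integrable x b.
Proof.
move=> sx ib.
have mb : measurable_fun (`[0, +oo[%classic : set R) (fun t => expR (- s * t) * b t).
  by apply/measurable_EFinP; exact: measurable_int ib.
apply: (@integrable_le _ _ _ (fun t => `|expR (- s * t) * b t|)) => //.
- rewrite (_ : (fun t => _) = (fun t => expR ((s - x) * t) * (expR (- s * t) * b t))).
    apply: measurable_funM => //; apply: measurable_funTS.
    by apply: measurableT_comp => //; exact: mulrl_measurable.
  by apply/funext => t; rewrite mulrA -expRD; congr (expR _ * _); ring.
- exact: integrable_norm.
move=> t; rewrite /= in_itv/= andbT => t0.
rewrite !normrM ler_wpM2r// !ger0_norm ?expR_ge0// ler_expR.
by rewrite ler_wpM2r// lerN2.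
Qed.

Lemma laplaceE b x y : laplace_integrable x b ->
  laplace b (Complex x y) = Complex (laplace_part cos b x y) (- laplace_part sin b x y).
Proof.
move=> ib; rewrite /laplace /cRintegral.
have E t : cexp (- (Complex x y) * (real_complex R t)) * (real_complex R (b t)) =
    Complex (expR (- x * t) * cos (y * t) * b t) (- 1 * (expR (- x * t) * sin (y * t) * b t)).
  rewrite /cexp; simpc => /=; rewrite ?(mulNr, cosN, sinN, mulrN).
  by congr Complex; ring.
congr Complex.
  by apply: eq_Rintegral => t _; rewrite E.
rewrite -[RHS]mulN1r -RintegralZl//.
  by apply: eq_Rintegral => t _; rewrite E.
by apply: laplace_part_integrable => //; [exact: continuous_sin|exact: sin_max].
Qed.

Lemma laplace_integrable_Phi a x : 0 < a -> 0 < x -> laplace_integrable x (Phi a).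
Proof.
move=> a0 x0; have := Phi_expR_integrable a0 x0.
move=> /(integrable_mono measurableT (measurable_itv `[0, +oo[) (@subsetT _ _)).
by apply: integrable_ext => // t _ /=; rewrite mulrC.
Qed.

Lemma laplace_part_Phi g a x y : continuous g -> (forall u, `|g u| <= 1) ->
  0 < a -> 0 < x ->
  laplace_part g (Phi a) x y = (Gamma a)^-1 * wave_int g (a - 1) x y.
Proof.
move=> cg g1 a0 x0; rewrite /laplace_part.
have i := laplace_part_integrable y cg g1 (laplace_integrable_Phi a0 x0).
rewrite -Rintegral_itv_obnd_cbnd; last first.
  by apply: integrableS i => //; apply: subset_itvr; rewrite bnd_simp.
rewrite -RintegralZl//; last by apply: wave_integrable => //; lra.
apply: eq_Rintegral => t; rewrite inE/= in_itv/= andbT => t0.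
by rewrite Phi_pos//; ring.
Qed.

Lemma cpow_half_plane x y a : 0 < x ->
  cpow (Complex x y) (real_complex R a) =
  Complex (expR (a / 2 * ln (x ^+ 2 + y ^+ 2)) * cos (a * atan (y / x)))
          (expR (a / 2 * ln (x ^+ 2 + y ^+ 2)) * sin (a * atan (y / x))).
Proof.
move=> x0; have r0 : 0 < x ^+ 2 + y ^+ 2.
  by rewrite ltr_pwDl ?sqr_ge0 ?exprn_gt0.
rewrite /cpow /clog /cexp /=; simpc => /=.
have -> : ln (Num.sqrt (x ^+ 2 + y ^+ 2)) = ln (x ^+ 2 + y ^+ 2) / 2.
  rewrite -[in RHS](@sqr_sqrtr _ (x ^+ 2 + y ^+ 2)) ?ltW// lnXn ?sqrtr_gt0//.
  by rewrite -[_ *+ 2]mulr_natl; field.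
by congr (Complex (expR _ * _) (expR _ * _)); field.
Qed.

Lemma laplace_Phi a x y : 0 < a -> 0 < x ->
  laplace (Phi a) (Complex x y) = cpow (Complex x y) (real_complex R (- a)).
Proof.
move=> a0 x0.
rewrite laplaceE; last exact: laplace_integrable_Phi.
rewrite !laplace_part_Phi//; [|exact: continuous_sin|exact: sin_max
  |exact: continuous_cos|exact: cos_max].
rewrite cpow_half_plane// !mulNr cosN sinN expRN.
have := wave_int_polar y a0 x0.
have G0 := Gamma_gt0 a0.
rewrite -Gamma_Euler//=; set P := expR _; set th := a * _.
set Kc := wave_int cos _ _ _; set Ks := wave_int sin _ _ _.
have P0 : P != 0 by rewrite gt_eqF// expR_gt0.
move=> [E1 E2].
have {}E2 : Kc * sin th - Ks * cos th = 0.
  by apply: (mulfI P0); rewrite E2 mulr0.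
have {}E1 : Kc * cos th + Ks * sin th = P^-1 * Gamma a.
  by apply: (mulfI P0); rewrite E1 mulVKf.
have cs := cos2Dsin2 th.
have -> : Kc = P^-1 * Gamma a * cos th.
  transitivity (Kc * (cos th ^+ 2 + sin th ^+ 2)); first by rewrite cs mulr1.
  by rewrite -E1; transitivity ((Kc * cos th + Ks * sin th) * cos th +
    (Kc * sin th - Ks * cos th) * sin th); [ring|rewrite E2; ring].
have -> : Ks = P^-1 * Gamma a * sin th.
  transitivity (Ks * (cos th ^+ 2 + sin th ^+ 2)); first by rewrite cs mulr1.
  by rewrite -E1; transitivity ((Kc * cos th + Ks * sin th) * sin th -
    (Kc * sin th - Ks * cos th) * cos th); [ring|rewrite E2; ring].
by congr Complex; field; rewrite P0 gt_eqF.
Qed.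

(** The value of L(Phi_a) at a real point. It bounds the norm of convolution with
    Phi_a in the weighted spaces in which the equation is solved. *)
Lemma Rintegral_Phi_expR a x : 0 < a -> 0 < x ->
  \int[mu]_t (Phi a t * expR (- x * t)) = x `^ (- a).
Proof.
move=> a0 x0.
have := laplace_Phi 0 a0 x0.
rewrite laplaceE; last exact: laplace_integrable_Phi.
rewrite cpow_half_plane// => -[+ _].
rewrite mul0r atan0 mulr0 cos0 mulr1 expr0n/= addr0 lnXn// -[ln x *+ 2]mulr_natl.
have -> : - a / 2 * (2 * ln x) = - a * ln x by field.
rewrite /powR gt_eqF// => <-.
rewrite /laplace_part Rintegral_mkcond; apply: eq_Rintegral => t _.
rewrite /patch; case: ifPn => [_|]; first by rewrite mul0r cos0 mulr1 mulrC.
rewrite notin_setE/= in_itv/= andbT => /negP; rewrite -ltNge => t0.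
by rewrite Phi_neg// mul0r.
Qed.

Lemma cpow_mulVr x y a : 0 < x ->
  cpow (Complex x y) (real_complex R (- a)) * cpow (Complex x y) (real_complex R a) = 1.
Proof.
move=> x0; rewrite !cpow_half_plane// !mulNr cosN sinN expRN; simpc.
set P := expR _; set th := a * _.
have P0 : P != 0 by rewrite gt_eqF// expR_gt0.
have cs := cos2Dsin2 th.
rewrite -[1]/(Complex 1 0); congr Complex.
  by rewrite -[RHS]cs; field.
by field.
Qed.

End Phi_laplace.


(** * Convolution with Phi and Fubini's theorem *)

Section real_fubini.
Context {R : realType}.
Notation mu := (@lebesgue_measure R).

(** A real-valued integral is 0 by convention when the integrand is measurable
    but not integrable, and then both sides vanish. This spares a discussion of
    the null set on which a convolution may diverge. *)
Lemma RintegralZ (D : set R) (k : R) (f : R -> R) : measurable D -> measurable_fun D f ->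
  \int[mu]_(x in D) (k * f x) = k * \int[mu]_(x in D) f x.
Proof.
move=> mD mf; have [->|k0] := eqVneq k 0.
  rewrite mul0r (@eq_Rintegral _ _ _ _ _ (cst 0)) ?Rintegral_cst ?mul0r//.
  by move=> x _; rewrite mul0r.
have Rint0 (g : R -> R) : measurable_fun D g ->
    ~ mu.-integrable D (EFin \o g) -> \int[mu]_(x in D) g x = 0.
  move=> mg nig; rewrite /Rintegral.
  have : ~ (\int[mu]_(x in D) (g x)%:E)%E \is a fin_num.
    rewrite -integral_fin_num_abs// => ig; apply: nig.
    by apply/integrableP; split => //; exact/measurable_EFinP.
  by case: (\int[mu]_(x in D) (g x)%:E)%E => [r h|//|//]; exfalso; exact: h.
have [fi|nfi] := pselect (mu.-integrable D (EFin \o f)); first exact: RintegralZl.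
rewrite !Rint0 ?mulr0//; first exact: measurable_funM.
move=> kfi; apply: nfi.
apply: (@integrable_ext _ _ (fun x => k^-1 * (k * f x))) => //.
  by move=> t _; rewrite mulKf.
exact: integrable_cmul.
Qed.

(** The inner integrals are finite almost everywhere only, but their finite
    parts form a measurable function and are not changed outside a null set. *)
Lemma Rintegral_fubini (G : R * R -> R) :
  (mu \x mu)%E.-integrable setT (EFin \o G) ->
  mu.-integrable setT (EFin \o (fun t => \int[mu]_s G (s, t))) /\
  \int[mu]_t \int[mu]_s G (s, t) = \int[mu]_s \int[mu]_t G (s, t).
Proof.
move=> iG.
have mG := measurable_int _ iG.
have mA := measurableT_comp (@abse_measurable R setT) mG.
have iG2 : mu.-integrable setT (fubini_G mu (EFin \o G)).
  apply/integrableP; split; first exact: (measurable_fubini_G iG).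
  have := (integrable21ltyP _ _ mG).1 iG; apply: le_lt_trans.
  apply: ge0_le_integral => //.
  - by apply: measurableT_comp => //; exact: (measurable_fubini_G iG).
  - exact: (measurable_fun_fubini_tonelli_G _ mA (fun=> abse_ge0 _)).
  - move=> t _; apply: le_abse_integral => //.
    exact: (measurableT_comp mG (measurable_pair2 t)).
have iG1 := integrable_fubini_F iG.
have e2 : ae_eq mu setT (fubini_G mu (EFin \o G))
    (EFin \o (fun t => \int[mu]_s G (s, t))).
  have := ae_integrable2 iG; apply: (@filterS _ _ (ae_filter_ringOfSetsType mu)).
  move=> t /= it _; rewrite /fubini_G /Rintegral fineK//.
  exact: (@integrable_fin_num _ _ _ mu setT _ (fun s => (G (s, t))%:E)).
have e1 : ae_eq mu setT (fubini_F mu (EFin \o G))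
    (EFin \o (fun s => \int[mu]_t G (s, t))).
  have := ae_integrable1 iG; apply: (@filterS _ _ (ae_filter_ringOfSetsType mu)).
  move=> t /= it _; rewrite /fubini_F /Rintegral fineK//.
  exact: (@integrable_fin_num _ _ _ mu setT _ (fun s => (G (t, s))%:E)).
have m2 : measurable_fun setT (EFin \o (fun t => \int[mu]_s G (s, t))).
  apply/measurable_EFinP.
  apply: (@measurableT_comp _ _ _ _ _ _ fine) => //; exact: measurable_int iG2.
have m1 : measurable_fun setT (EFin \o (fun s => \int[mu]_t G (s, t))).
  apply/measurable_EFinP.
  apply: (@measurableT_comp _ _ _ _ _ _ fine) => //; exact: measurable_int iG1.
split.
  have [_ l] := integrableP _ _ _ iG2.
  apply/integrableP; split => //.
  rewrite (@ae_eq_integral _ _ _ mu setT (fun t => `|fubini_G mu (EFin \o G) t|%E))//.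
  - exact: measurableT_comp.
  - by apply: measurableT_comp => //; exact: measurable_int iG2.
  - apply: (@filterS _ _ (ae_filter_ringOfSetsType mu)) e2 => t /= h _.
    by rewrite h.
rewrite /(Rintegral mu setT (fun t => \int[mu]_s G (s, t))) /(Rintegral mu setT (fun s => \int[mu]_t G (s, t))).
congr fine.
have <- : (\int[mu]_t fubini_G mu (EFin \o G) t = \int[mu]_t (\int[mu]_s G (s, t))%:E)%E.
  by apply: ae_eq_integral => //; exact: measurable_int iG2.
have <- : (\int[mu]_t fubini_F mu (EFin \o G) t = \int[mu]_s (\int[mu]_t G (s, t))%:E)%E.
  by apply: ae_eq_integral => //; exact: measurable_int iG1.
by rewrite (Fubini iG).
Qed.

Lemma integral_shift (c : R) (f : R -> R) : mu.-integrable setT (EFin \o f) ->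
  mu.-integrable setT (EFin \o (fun x => f (x - c))) /\
  \int[mu]_x f (x - c) = \int[mu]_x f x.
Proof.
move=> fi.
have gi := integrable_reflect 0 fi.
have g'i := integrable_reflect c gi.
have E x : f (0 - (c - x)) = f (x - c) by congr f; ring.
split; first by apply: (integrable_ext _ _ g'i) => // t _; rewrite E.
rewrite /Rintegral -(integral_reflect 0 fi) -(integral_reflect c gi).
by congr fine; apply: eq_integral => t _ /=; rewrite E.
Qed.

End real_fubini.

Section convolution.
Context {R : realType}.
Notation mu := (@lebesgue_measure R).
Implicit Types (a x t : R) (v e : R -> R).

(** As Phi vanishes on the negative half-line, the domain of integration does
    not have to depend on t. *)
Lemma Phi_convE a v t :
  Phi_conv a v t = \int[mu]_s (Phi a (t - s) * (v \_ `[0, +oo[) s).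
Proof.
rewrite /Phi_conv Rintegral_mkcond; apply: eq_Rintegral => s _.
rewrite !patchE; case: ifPn => [|].
  rewrite inE/= in_itv/= => /andP[s0 _].
  by rewrite mem_set//= in_itv/= s0.
rewrite notin_setE/= in_itv/= => /negP; rewrite negb_and -!ltNge => /orP[s0|ts].
  by rewrite memNset ?mulr0//= in_itv/= andbT leNgt s0.
by rewrite Phi_neg ?mul0r// subr_lt0.
Qed.

(** The convolution is tested against a function e of exponential decay, for
    the absolute convergence of the double integral. The change of variables
    t = s + r in the inner integral makes the convolution disappear. *)
Lemma Phi_conv_fubini a x M e v : 0 < a -> 0 < x ->
  measurable_fun setT e ->
  (forall t, 0 <= t -> `|e t| <= M * expR (- x * t)) ->
  laplace_integrable x v ->
  mu.-integrable `[0, +oo[ (EFin \o (fun t => e t * Phi_conv a v t)) /\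
  \int[mu]_(t in `[0, +oo[) (e t * Phi_conv a v t) =
  \int[mu]_(s in `[0, +oo[) ((\int[mu]_r (e (s + r) * Phi a r)) * v s).
Proof.
move=> a0 x0 me eM iv.
have mD : measurable (`[0, +oo[%classic : set R) by exact: measurable_itv.
pose v0 := v \_ `[0, +oo[.
have mv : measurable_fun (`[0, +oo[%classic : set R) v.
  rewrite (_ : v = fun t => expR (x * t) * (expR (- x * t) * v t)).
    apply: measurable_funM; last exact: integrable_measurable iv.
    apply: measurable_funTS; apply: measurableT_comp => //.
  by apply/funext => t; rewrite mulrA -expRD mulNr subrr expR0 mul1r.
have mv0 : measurable_fun setT v0 by apply/(measurable_restrictT _ mD).
pose h t := Phi a t * expR (- x * t).
have ih : mu.-integrable setT (EFin \o h) := Phi_expR_integrable a0 x0.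
have h0 t : 0 <= h t by rewrite mulr_ge0 ?Phi_ge0 ?expR_ge0.
pose G (z : R * R) := e z.2 * (Phi a (z.2 - z.1) * v0 z.1).
have mfst : measurable_fun setT (fst : R * R -> R) by exact: measurable_fst.
have msnd : measurable_fun setT (snd : R * R -> R) by exact: measurable_snd.
have mG : measurable_fun setT G.
  apply: measurable_funM; first exact: measurableT_comp.
  apply: measurable_funM; last exact: measurableT_comp.
  apply: (@measurableT_comp _ _ _ _ _ _ (Phi a)); first exact: measurable_Phi.
  exact: measurable_funB.
have bG s t : `|G (s, t)| <= M * (expR (- x * s) * `|v0 s|) * h (t - s).
  rewrite /G/= /h !normrM (ger0_norm (Phi_ge0 _ a0)).
  have M0 : 0 <= M.
    by have := eM 0 (lexx _); rewrite mulr0 expR0 mulr1; apply: le_trans.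
  have [s0|s0] := ltP s 0.
    by rewrite /v0 patchE memNset ?normr0 ?mulr0 ?mul0r//= in_itv/= andbT leNgt s0.
  have [ts|ts] := ltP t s; first by rewrite Phi_neg ?subr_lt0// !(mul0r, mulr0).
  have t0 : 0 <= t by exact: le_trans ts.
  have -> : M * (expR (- x * s) * `|v0 s|) * (Phi a (t - s) * expR (- x * (t - s))) =
     M * expR (- x * t) * (Phi a (t - s) * `|v0 s|).
    have -> : expR (- x * t) = expR (- x * s) * expR (- x * (t - s)).
      by rewrite -expRD; congr expR; ring.
    ring.
  by rewrite ler_wpM2r ?mulr_ge0 ?Phi_ge0// eM.
have iv0 : mu.-integrable setT (EFin \o (fun s => expR (- x * s) * `|v0 s|)).
  have /(integrable_patch _ mD) := integrable_norm iv.
  apply: integrable_ext => // t _; rewrite /v0 !patchE; case: ifP => _.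
    by rewrite /= normrM ger0_norm// expR_ge0.
  by rewrite normr0 mulr0.
have hs s := integral_shift s ih.
have iGt s : mu.-integrable setT (EFin \o (fun t => G (s, t))).
  apply: (integrable_le _ _ (integrable_cmul (M * (expR (- x * s) * `|v0 s|)) measurableT (hs s).1)) => //.
  by apply: measurableT_comp => //; exact: measurable_pair1.
have iG : (mu \x mu)%E.-integrable setT (EFin \o G).
  have mE : measurable_fun setT (EFin \o G) by exact/measurable_EFinP.
  have mA : measurable_fun [set: measurableTypeR R * measurableTypeR R]
    (abse \o (EFin \o G)) by exact: measurableT_comp.
  apply/integrable12ltyP => //.
  have iC := integrable_cmul (M * x `^ (- a)) measurableT iv0.
  have [_] := integrableP _ _ _ iC; apply: le_lt_trans.
  apply: ge0_le_integral => //.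
  - by move=> s _; exact: integral_ge0.
  - exact: (measurable_fun_fubini_tonelli_F _ mA (fun=> abse_ge0 _)).
  - by apply: measurableT_comp => //; exact: measurable_int iC.
  move=> s _.
  have -> : (\int[mu]_t `|(EFin \o G) (s, t)| = (\int[mu]_t `|G (s, t)|)%:E)%E.
    rewrite /Rintegral fineK//.
    exact: (@integrable_fin_num _ _ _ mu setT _ (EFin \o (fun t => `|G (s, t)|)) (integrable_norm (iGt s))).
  rewrite /= lee_fin.
  apply: (@le_trans _ _ (\int[mu]_t (M * (expR (- x * s) * `|v0 s|) * h (t - s)))).
    apply: le_Rintegral => //; first exact: (integrable_norm (iGt s)).
    exact: (integrable_cmul _ measurableT (hs s).1).
  rewrite RintegralZl//; last exact: (hs s).1.
  rewrite (hs s).2 /h Rintegral_Phi_expR// (le_trans _ (ler_norm _))//.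
  by rewrite mulrAC.
have [i2 E2] := Rintegral_fubini iG.
have cE t : \int[mu]_s G (s, t) = e t * Phi_conv a v t.
  rewrite Phi_convE -RintegralZ//; apply: measurable_funM => //.
  apply: (@measurableT_comp _ _ _ _ _ _ (Phi a)); first exact: measurable_Phi.
  exact: measurable_funB.
have conv0 t : t < 0 -> Phi_conv a v t = 0.
  move=> t0; rewrite /Phi_conv set_itv_ge ?Rintegral_set0// bnd_simp -ltNge.
  exact: t0.
split.
  apply: (integrable_mono measurableT mD (@subsetT _ _)).
  by apply: (integrable_ext _ _ i2) => // t _; rewrite cE.
rewrite [LHS]Rintegral_mkcond [RHS]Rintegral_mkcond.
transitivity (\int[mu]_t \int[mu]_s G (s, t)).
  apply: eq_Rintegral => t _; rewrite cE patchE; case: ifPn => //.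
  by rewrite notin_setE/= in_itv/= andbT => /negP; rewrite -ltNge => /conv0 ->; rewrite mulr0.
rewrite E2; apply: eq_Rintegral => s _.
rewrite patchE; case: ifPn => [|]; last first.
  move=> sD; rewrite (@eq_Rintegral _ _ _ _ _ (cst 0)) ?Rintegral_cst ?mul0r//.
  by move=> t _; rewrite /G/= /v0 patchE (negbTE sD) !mulr0.
rewrite inE/= in_itv/= andbT => s0.
have vs : v0 s = v s by rewrite /v0 patchE mem_set//= in_itv/= s0.
have ie : mu.-integrable setT (EFin \o (fun r => e (s + r) * Phi a r)).
  apply: (integrable_le _ _ (integrable_cmul (M * expR (- x * s)) measurableT ih)) => //.
    apply: measurable_funM; last exact: measurable_Phi.
    by apply: measurableT_comp => //; exact: measurable_funD.
  move=> r _; have [r0|r0] := ltP r 0.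
    by rewrite /h Phi_neg// !(mulr0, mul0r) normr0.
  rewrite normrM (ger0_norm (Phi_ge0 _ a0)) /h.
  have -> : M * expR (- x * s) * (Phi a r * expR (- x * r)) =
      M * expR (- x * (s + r)) * Phi a r.
    by rewrite mulrDr expRD; ring.
  by rewrite ler_wpM2r ?Phi_ge0// eM// addr_ge0.
rewrite [RHS]mulrC -RintegralZl//.
have [_ <-] := integral_shift s (integrable_cmul (v s) measurableT ie).
apply: eq_Rintegral => t _; rewrite /G/= vs.
have -> : s + (t - s) = t by rewrite addrC subrK.
by ring.
Qed.

End convolution.


(** * Convolution theorem, growth and continuity *)

Section convolution_estimates.
Context {R : realType}.
Notation mu := (@lebesgue_measure R).
Implicit Types (a x t : R) (v f : R -> R).

Lemma laplace_part_PhiT (g : R -> R) a x y :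
  laplace_part g (Phi a) x y = \int[mu]_r (expR (- x * r) * g (y * r) * Phi a r).
Proof.
rewrite /laplace_part Rintegral_mkcond; apply: eq_Rintegral => t _.
rewrite patchE; case: ifPn => //.
rewrite notin_setE/= in_itv/= andbT => /negP; rewrite -ltNge => t0.
by rewrite Phi_neg// mulr0.
Qed.

(** The addition formulas for e^(-xt) cos(yt) and e^(-xt) sin(yt) turn the inner
    integral of [Phi_conv_fubini] into the real and imaginary parts of
    e^(-ps) L(Phi_a)(p). *)
Lemma laplace_Phi_conv a x y v : 0 < a -> 0 < x -> laplace_integrable x v ->
  laplace_integrable x (Phi_conv a v) /\
  laplace (Phi_conv a v) (Complex x y) =
  cpow (Complex x y) (real_complex R (- a)) * laplace v (Complex x y).
Proof.
move=> a0 x0 iv.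
have me (g : R -> R) : continuous g -> measurable_fun setT (fun t => expR (- x * t) * g (y * t)).
  move=> cg; apply: measurable_funM.
    by apply: measurableT_comp => //; exact: mulrl_measurable.
  apply: (@measurableT_comp _ _ _ _ _ _ g); first exact: continuous_measurable_fun.
  exact: mulrl_measurable.
have eM (g : R -> R) t : (forall u, `|g u| <= 1) -> 0 <= t ->
    `|expR (- x * t) * g (y * t)| <= 1 * expR (- x * t).
  by move=> g1 t0; rewrite normrM ger0_norm ?expR_ge0// mul1r ler_piMr ?expR_ge0.
have ccos : continuous (@cos R) by exact: continuous_cos.
have csin : continuous (@sin R) by exact: continuous_sin.
have cos1 (u : R) : `|cos u| <= 1 by exact: cos_max.
have sin1 (u : R) : `|sin u| <= 1 by exact: sin_max.
have m0 : measurable_fun setT (fun t : R => expR (- x * t)).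
  by apply: measurableT_comp => //; exact: mulrl_measurable.
have e0 t : 0 <= t -> `|expR (- x * t)| <= 1 * expR (- x * t).
  by rewrite mul1r ger0_norm// expR_ge0.
have [ic _] := Phi_conv_fubini a0 x0 m0 e0 iv.
have [_ Ec] := Phi_conv_fubini a0 x0 (me _ ccos) (fun t => eM _ t cos1) iv.
have [_ Es] := Phi_conv_fubini a0 x0 (me _ csin) (fun t => eM _ t sin1) iv.
split; first exact: ic.
rewrite -laplace_Phi// !laplaceE//; last exact: laplace_integrable_Phi.
have iF (g : R -> R) : continuous g -> (forall u, `|g u| <= 1) ->
    mu.-integrable setT (EFin \o (fun r => expR (- x * r) * g (y * r) * Phi a r)).
  move=> cg g1; apply: (integrable_le _ _ (Phi_expR_integrable a0 x0)) => //.
    by apply: measurable_funM; [exact: me|exact: measurable_Phi].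
  move=> r _; rewrite mulrAC [expR _ * _]mulrC normrM.
  rewrite ger0_norm ?mulr_ge0 ?expR_ge0 ?Phi_ge0//.
  by rewrite ler_piMr ?mulr_ge0 ?expR_ge0 ?Phi_ge0.
have iFc := iF _ ccos cos1; have iFs := iF _ csin sin1.
have iVc := laplace_part_integrable y ccos cos1 iv.
have iVs := laplace_part_integrable y csin sin1 iv.
set Fc := laplace_part cos (Phi a) x y; set Fs := laplace_part sin (Phi a) x y.
set Vc := laplace_part cos v x y; set Vs := laplace_part sin v x y.
have Ac s : \int[mu]_r (expR (- x * (s + r)) * cos (y * (s + r)) * Phi a r) =
    expR (- x * s) * (cos (y * s) * Fc - sin (y * s) * Fs).
  rewrite /Fc /Fs !laplace_part_PhiT mulrBr !mulrA -!RintegralZl//.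
  rewrite -RintegralB//; [|exact: integrable_cmul..].
  by apply: eq_Rintegral => r _; rewrite !mulrDr expRD cosD; ring.
have As s : \int[mu]_r (expR (- x * (s + r)) * sin (y * (s + r)) * Phi a r) =
    expR (- x * s) * (sin (y * s) * Fc + cos (y * s) * Fs).
  rewrite /Fc /Fs !laplace_part_PhiT mulrDr !mulrA -!RintegralZl//.
  rewrite -RintegralD//; [|exact: integrable_cmul..].
  by apply: eq_Rintegral => r _; rewrite !mulrDr expRD sinD; ring.
have Lc : laplace_part cos (Phi_conv a v) x y = Fc * Vc - Fs * Vs.
  rewrite /laplace_part Ec /Vc /Vs /laplace_part -!RintegralZl//.
  rewrite -RintegralB//; [|exact: integrable_cmul..].
  by apply: eq_Rintegral => s _; rewrite Ac; ring.
have Ls : laplace_part sin (Phi_conv a v) x y = Fc * Vs + Fs * Vc.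
  rewrite /laplace_part Es /Vc /Vs /laplace_part -!RintegralZl//.
  rewrite -RintegralD//; [|exact: integrable_cmul..].
  by apply: eq_Rintegral => s _; rewrite As; ring.
by rewrite Lc Ls; simpc; congr Complex; ring.
Qed.

(** The exponentials e^(xt) are almost eigenfunctions of convolution with Phi_a,
    with eigenvalue L(Phi_a)(x); integrating over s < 0 as well makes this
    exact. *)
Lemma expR_conv_integrable a x t : 0 < a -> 0 < x ->
  mu.-integrable setT (EFin \o (fun s => Phi a (t - s) * expR (x * s))) /\
  \int[mu]_s (Phi a (t - s) * expR (x * s)) = x `^ (- a) * expR (x * t).
Proof.
move=> a0 x0; have ih := Phi_expR_integrable a0 x0.
have ir := integrable_reflect t ih.
have E s : expR (x * t) * (Phi a (t - s) * expR (- x * (t - s))) = Phi a (t - s) * expR (x * s).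
  rewrite mulrCA -expRD; congr (_ * expR _); ring.
split.
  by apply: (integrable_ext _ _ (integrable_cmul (expR (x * t)) measurableT ir)) => // s _; rewrite E.
rewrite -(Rintegral_Phi_expR a0 x0).
transitivity (\int[mu]_s (expR (x * t) * (Phi a (t - s) * expR (- x * (t - s))))).
  by apply: eq_Rintegral => s _; rewrite E.
rewrite RintegralZl// mulrC; congr (_ * _).
by rewrite /Rintegral (integral_reflect t ih).
Qed.

Lemma Phi_conv_integrable a x M f t : 0 < a -> 0 < x ->
  measurable_fun `[0, t] f ->
  (forall s, 0 <= s <= t -> `|f s| <= M * expR (x * s)) ->
  mu.-integrable `[0, t] (EFin \o (fun s => Phi a (t - s) * f s)).
Proof.
move=> a0 x0 mf fM.
have mD : measurable (`[0, t]%classic : set R) by exact: measurable_itv.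
have ie := integrable_mono measurableT mD (@subsetT _ _) (expR_conv_integrable t a0 x0).1.
apply: (integrable_le _ _ (integrable_cmul M mD ie)) => //.
  apply: measurable_funM => //; apply: measurable_funTS.
  apply: (@measurableT_comp _ _ _ _ _ _ (Phi a)); first exact: measurable_Phi.
  exact: measurable_funB.
move=> s /=; rewrite in_itv/= => st.
rewrite normrM (ger0_norm (Phi_ge0 _ a0)) mulrCA.
by rewrite ler_wpM2l ?Phi_ge0// fM.
Qed.

Lemma Phi_conv_bound a x M f t : 0 < a -> 0 < x -> 0 <= M ->
  measurable_fun `[0, t] f ->
  (forall s, 0 <= s <= t -> `|f s| <= M * expR (x * s)) ->
  `|Phi_conv a f t| <= x `^ (- a) * M * expR (x * t).
Proof.
move=> a0 x0 M0 mf fM.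
have mD : measurable (`[0, t]%classic : set R) by exact: measurable_itv.
have [ie Ee] := expR_conv_integrable t a0 x0.
have fi := Phi_conv_integrable a0 x0 mf fM.
apply: (@le_trans _ _ (\int[mu]_(s in `[0, t]) `|Phi a (t - s) * f s|)).
  exact: le_normr_Rintegral.
rewrite mulrAC -Ee mulrC -RintegralZl// Rintegral_mkcond.
apply: le_Rintegral => //; [|exact: integrable_cmul|].
  exact/(integrable_patch _ mD)/integrable_norm.
move=> s _; rewrite patchE; case: ifPn => [|_].
  rewrite inE/= in_itv/= => st.
  by rewrite normrM (ger0_norm (Phi_ge0 _ a0)) mulrCA ler_wpM2l ?Phi_ge0// fM.
by rewrite !mulr_ge0 ?Phi_ge0 ?expR_ge0.
Qed.

(** After the substitution r = t - s the singular factor Phi_a(r) does not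
    depend on t, and the other factor is continuous in t for r <> t, so
    dominated convergence applies. *)
Lemma Phi_conv_continuous a M f : 0 < a -> continuous f ->
  (forall s, `|f s| <= M) -> continuous (Phi_conv a f).
Proof.
move=> a0 cf fM.
have M0 : 0 <= M by apply: le_trans (fM 0).
have mD : measurable (`[0, +oo[%classic : set R) by exact: measurable_itv.
pose f0 := f \_ `[0, +oo[.
have mf : measurable_fun setT f by exact: continuous_measurable_fun.
have mf0 : measurable_fun setT f0.
  by apply/(measurable_restrictT _ mD); exact: measurable_funTS.
have f0pos u : 0 <= u -> f0 u = f u.
  by move=> u0; rewrite /f0 patchE mem_set//= in_itv/= u0.
have f0neg u : u < 0 -> f0 u = 0.
  by move=> u0; rewrite /f0 patchE memNset//= in_itv/= andbT leNgt u0.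
have ltr01' := @ltr01 R.
have cE t : Phi_conv a f t = \int[mu]_r (Phi a r * f0 (t - r)).
  have it : mu.-integrable setT (EFin \o (fun s => Phi a (t - s) * f0 s)).
    have mT : measurable (`[0, t]%classic : set R) by exact: measurable_itv.
    have /(integrable_patch _ mT) : mu.-integrable `[0, t] (EFin \o (fun s => Phi a (t - s) * f s)).
      apply: (@Phi_conv_integrable _ 1 M) => //; first exact: measurable_funTS.
      move=> s /andP[s0 _]; rewrite (le_trans (fM _))// ler_peMr//.
      by rewrite -[leLHS]expR0 ler_expR mul1r.
    apply: integrable_ext => // s _; rewrite patchE.
    case: ifPn => [|].
      by rewrite inE/= in_itv/= => /andP[s0 _]; rewrite f0pos.
    rewrite notin_setE/= in_itv/= => /negP; rewrite negb_and -!ltNge => /orP[s0|ts].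
      by rewrite f0neg// mulr0.
    by rewrite Phi_neg ?mul0r// subr_lt0.
  rewrite Phi_convE /Rintegral -(integral_reflect t it).
  by congr fine; apply: eq_integral => r _; congr (Phi a _ * _)%:E; ring.
have cf0 u : u != 0 -> {for u, continuous f0}.
  move=> u0; suff : f0 z @[z --> u] --> f0 u by [].
  case: (ltgtP u 0) u0 => // u0 _.
  - rewrite f0neg//; apply: cvg_near_cst.
    by near=> z; apply: f0neg; near: z; exact: lt_nbhsl.
  - rewrite f0pos ?(ltW u0)//.
    apply: (cvg_trans _ (cf u)); apply: near_eq_cvg.
    by near=> z; rewrite f0pos// ltW//; near: z; exact: lt_nbhsr.
move=> t; apply/(@cvg_nbhsP _ R^o) => u ut.
(* The integrand at u n vanishes for r > u n; up to a common bound T of the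
   u n, the constant M is dominated by M e^(T - r), whose product with Phi_a
   is integrable on the whole line. *)
have [T [Tt Tu]] : exists T, t <= T /\ forall n, u n <= T.
  have /cvg_seq_bounded [N [_ HN]] : cvgn u by apply/cvg_ex; exists t.
  exists (Num.max t (N + 1)); rewrite le_max lexx; split=> // n.
  rewrite le_max; apply/orP; right; apply: le_trans (ler_norm _) _.
  by apply: HN => //; rewrite ltrDl.
rewrite cE -/(Phi_conv a f _); under eq_fun do rewrite -/(Phi_conv a f _) cE.
have mP : measurable_fun setT (Phi a) by exact: measurable_Phi.
have mtr (z : R) : measurable_fun setT (fun r => Phi a r * f0 (z - r)).
  apply: measurable_funM => //; apply: (@measurableT_comp _ _ _ _ _ _ f0) => //.
  exact: measurable_funB.
suff [] : mu.-integrable setT (EFin \o (fun r => Phi a r * f0 (t - r))) /\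
  \int[mu]_r (Phi a r * f0 (u n - r)) @[n --> \oo] --> \int[mu]_r (Phi a r * f0 (t - r)) by [].
apply: (@Rintegral_dominated_cvg _ setT (fun n r => Phi a r * f0 (u n - r))
  (fun r => Phi a r * f0 (t - r)) (fun r => M * expR T * (Phi a r * expR (- 1 * r)))) => //.
- (* The zero extension f0 of f may jump at 0, that is, at r = t. *)
  exists [set t]; split => //.
    by rewrite lebesgue_measure_set1.
  move=> r /=; apply: contra_notP => /eqP rt _.
  apply: cvgM; first exact: cvg_cst.
  have tr : t - r != 0 by rewrite subr_eq0 eq_sym.
  apply: (@cvg_comp _ _ _ (fun n => u n - r) f0 _ _ _ _ (cf0 _ tr)).
  by apply: cvgB => //; exact: cvg_cst.
- apply: integrable_cmul => //; exact: Phi_expR_integrable.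
- move=> n r _; rewrite normrM (ger0_norm (Phi_ge0 _ a0)).
  rewrite [leRHS]mulrCA ler_wpM2l ?Phi_ge0//.
  have [ur|ur] := ltP (u n - r) 0.
    by rewrite f0neg// normr0 !mulr_ge0 ?expR_ge0.
  rewrite f0pos// (le_trans (fM _))// -mulrA -expRD ler_peMr//.
  rewrite -[leLHS]expR0 ler_expR; have := Tu n; lra.
Unshelve. all: end_near. Qed.

(** The values of a convolution on [0, T] depend on f on [0, T] only, so f may
    be replaced by a bounded continuous extension to the line. *)
Lemma Phi_conv_within_continuous a f T : 0 < a -> 0 <= T ->
  {within `[0, T], continuous f} -> {within `[0, T], continuous (Phi_conv a f)}.
Proof.
move=> a0 T0 cf.
have [M [M0 HM]] : exists M, 0 < M /\ forall s, `[0, T]%classic s -> `|f s| <= M.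
  have /compact_bounded[M [_ HM]] := continuous_compact cf (@segment_compact _ 0 T).
  exists (`|M| + 1); split; first by rewrite ltr_wpDl.
  move=> s sT; apply: HM; last by exists s.
  by rewrite (le_lt_trans (ler_norm _))// ltrDl.
have cA : closed (`[0, T]%classic : set R^o) by exact: interval_closed.
have [g [fg cg gM]] :=
  continuous_bounded_extension (@pseudometric_normal R R^o) cA M0 cf HM.
have cc := Phi_conv_continuous a0 cg gM.
apply: (@subspace_eq_continuous _ _ _ (Phi_conv a g)).
  move=> t; rewrite inE/= in_itv/= => /andP[_ tT].
  apply: eq_Rintegral => s; rewrite inE/= in_itv/= => /andP[s0 st].
  by rewrite fg// inE/= in_itv/= s0 (le_trans st).
exact: continuous_subspaceT.
Qed.

End convolution_estimates.


(** * Injectivity of the Laplace transform *)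

Section laplace_uniqueness.
Context {R : realType}.
Notation mu := (@lebesgue_measure R).
Implicit Types (p q x t y : R) (w : R -> R).

Lemma expR_partial_sum_le y Y n : `|y| <= Y ->
  `|series (exp_coeff y) n| <= expR Y.
Proof.
move=> yY; apply: (@le_trans _ _ (series (exp_coeff `|y|) n)).
  rewrite /series/= (le_trans (ler_norm_sum _ _ _))//.
  apply: ler_sum => i _; rewrite /exp_coeff/= normrM normrX.
  by rewrite normfV (ger0_norm (ler0n _ _)).
apply: (@le_trans _ _ (expR `|y|)); last by rewrite ler_expR.
apply: nondecreasing_cvgn_le; last exact: is_cvg_series_exp_coeff.
apply/nondecreasing_seqP => k; rewrite seriesS lerDr /exp_coeff/=.
by rewrite mulr_ge0// invr_ge0.
Qed.

Let D0 : set R := `[0, +oo[%classic.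
Let mD0 : measurable D0. Proof. exact: measurable_itv. Qed.

Let mexp (k : R) : measurable_fun D0 (fun t => expR (k * t)).
Proof.
apply: measurable_funTS.
by apply: measurableT_comp => //; exact: mulrl_measurable.
Qed.

Lemma integrable_expR_damped w q : 0 <= q -> mu.-integrable D0 (EFin \o w) ->
  mu.-integrable D0 (EFin \o (fun t => expR (- q * t) * w t)).
Proof.
move=> q0 iw; have mw := integrable_measurable iw.
apply: (integrable_le _ _ (integrable_norm iw)) => //.
  by apply: measurable_funM => //; exact: mexp.
move=> t; rewrite /D0/= in_itv/= andbT => t0.
rewrite normrM ler_piMl// ger0_norm ?expR_ge0// -expR0 ler_expR mulNr oppr_le0.
exact: mulr_ge0.
Qed.

(** Term by term integration of the exponential series of - e^(p (x - t)). The
    term of order n is a multiple of the Laplace integral of w at np, which is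
    zero for n > 0; dominated convergence applies because e^(p (x - t)) is at
    most e^(px) on the half-line. *)
Lemma Rintegral_double_exp w p x : mu.-integrable D0 (EFin \o w) ->
  (forall q, 0 < q -> \int[mu]_(t in D0) (expR (- q * t) * w t) = 0) ->
  0 < p -> 0 <= x ->
  \int[mu]_(t in D0) (w t * expR (- expR (p * (x - t)))) = \int[mu]_(t in D0) w t.
Proof.
move=> iw w0 p0 x0; have mw := integrable_measurable iw.
pose y t := - expR (p * (x - t)).
have yE t k : y t ^+ k = (- 1) ^+ k * expR (k%:R * (p * x)) * expR (- (k%:R * p) * t).
  rewrite /y [in LHS]exprNn -expRM_natl -mulrA -expRD; congr (_ * expR _); ring.
pose term k t := (- 1) ^+ k * expR (k%:R * (p * x)) / k`!%:R *
   (expR (- (k%:R * p) * t) * w t).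
have termE k t : term k t = w t * exp_coeff (y t) k.
  by rewrite /term /exp_coeff/= yE; ring.
have it k : mu.-integrable D0 (EFin \o term k).
  by apply: integrable_cmul => //; apply: integrable_expR_damped => //;
    rewrite mulr_ge0// ltW.
pose f n t := w t * series (exp_coeff (y t)) n.
have fS n t : f n.+1 t = f n t + term n t.
  by rewrite /f seriesS termE mulrDr addrC.
have f1 : f 1%N = w.
  apply/funext => t; rewrite fS /f /series/= big_nil mulr0 add0r.
  by rewrite termE /exp_coeff/= expr0 fact0 divr1 mulr1.
have iff n : mu.-integrable D0 (EFin \o f n.+1) /\
    \int[mu]_(t in D0) f n.+1 t = \int[mu]_(t in D0) w t.
  elim: n => [|n [ifn En]]; first by rewrite f1.
  have -> : f n.+2 = (fun t => f n.+1 t + term n.+1 t) by apply/funext => t.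
  split; first exact: integrable_add.
  rewrite RintegralD// En /term RintegralZl//; last first.
    by apply: integrable_expR_damped => //; rewrite mulr_ge0// ltW.
  by rewrite w0 ?mulr0 ?addr0// mulr_gt0.
have yb t : D0 t -> `|y t| <= expR (p * x).
  rewrite /D0/= in_itv/= andbT => t0.
  by rewrite /y normrN ger0_norm ?expR_ge0// ler_expR ler_pM2l//; lra.
have [_ cv] : mu.-integrable D0 (EFin \o (fun t => w t * expR (y t))) /\
    \int[mu]_(t in D0) f n.+1 t @[n --> \oo] --> \int[mu]_(t in D0) (w t * expR (y t)).
  apply: (@Rintegral_dominated_cvg _ D0 (fun n => f n.+1) _
    (fun t => expR (expR (p * x)) * `|w t|)) => //.
  - by move=> n; exact: integrable_measurable (iff n).1.
  - apply: measurable_funM => //.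
    apply: measurable_funTS; apply: measurableT_comp => //.
    apply: measurableT_comp => //; apply: measurableT_comp => //.
    apply: measurable_funM => //; exact: measurable_funB.
  - apply: aeW => t _; rewrite /f; apply: cvgM; first exact: cvg_cst.
    rewrite (cvg_shiftS (fun n => series (exp_coeff (y t)) n)).
    exact: is_cvg_series_exp_coeff.
  - by apply: integrable_cmul => //; exact: integrable_norm.
  - move=> n t Dt; rewrite /f normrM mulrC ler_wpM2r// expR_partial_sum_le//.
    exact: yb.
have Ef : (fun n => \int[mu]_(t in D0) f n.+1 t) = (fun=> \int[mu]_(t in D0) w t).
  by apply/funext => n; rewrite (iff n).2.
rewrite Ef in cv.
exact: (cvg_unique _ cv (cvg_cst _)).
Qed.

Lemma double_exp_cvg (d : R) : d != 0 ->
  expR (- expR (n%:R * d)) @[n --> \oo] --> ((d < 0)%R%:R : R).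
Proof.
have aux (e : R) : 0 < e -> expR (- (n%:R * e)) @[n --> \oo] --> (0 : R).
  move=> e0; have h : (n%:R * e : R) @[n --> \oo] --> +oo.
    apply: (cvg_comp _ _ (@cvgr_idn R) (@gt0_cvgMly R _ _ e idfun e0 _)); exact: cvg_id.
  exact: (cvg_comp _ _ h (@cvgr_expR R)).
case: (ltgtP d 0) => // d0 _ /=.
  have h : - expR (n%:R * d) @[n --> \oo] --> (0 : R).
    rewrite -oppr0; apply: cvgN; have := aux (- d) (ltac:(lra)).
    by under eq_fun do rewrite mulrN opprK.
  have := @continuous_expR R 0; rewrite /continuous_at expR0 => ce.
  exact: (cvg_comp _ _ h ce).
apply: (@squeeze_cvgr _ _ _ _ (cst 0) (fun n => expR (- (n%:R * d)))) => //.
- near=> n; rewrite /= expR_ge0/= ler_expR lerN2.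
  by apply: le_trans (expR_ge1Dx _); rewrite lerDr.
- exact: cvg_cst.
- exact: aux.
Unshelve. all: end_near. Qed.

(** The limit p -> oo in [Rintegral_double_exp], along the integers. *)
Lemma laplace_zero_primitive w x : mu.-integrable D0 (EFin \o w) ->
  (forall q, 0 < q -> \int[mu]_(t in D0) (expR (- q * t) * w t) = 0) ->
  0 <= x -> \int[mu]_(t in `[0, x]) w t = 0.
Proof.
move=> iw w0 x0; have mw := integrable_measurable iw.
have E n : \int[mu]_(t in D0) (w t * expR (- expR (n.+1%:R * (x - t)))) = \int[mu]_(t in D0) w t.
  exact: Rintegral_double_exp.
have ms (n : nat) : measurable_fun D0 (fun t => w t * expR (- expR (n%:R * (x - t)))).
  apply: measurable_funM => //.
  apply: measurable_funTS; apply: measurableT_comp => //.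
  apply: measurableT_comp => //; apply: measurableT_comp => //.
  apply: measurable_funM => //; exact: measurable_funB.
have ml : measurable_fun D0 (fun t => w t * (x < t)%R%:R).
  apply: measurable_funM => //.
  rewrite (_ : (fun t => _) = \1_(`]x, +oo[%classic : set R)).
    by apply: measurable_indic; exact: measurable_itv.
  by apply/funext => t; rewrite indicE; congr (nat_of_bool _)%:R;
    apply/idP/idP; rewrite inE/= in_itv/= andbT.
have [il cv] : mu.-integrable D0 (EFin \o (fun t => w t * (x < t)%R%:R)) /\
    \int[mu]_(t in D0) (w t * expR (- expR (n.+1%:R * (x - t)))) @[n --> \oo] -->
    \int[mu]_(t in D0) (w t * (x < t)%R%:R).
  apply: (@Rintegral_dominated_cvg _ D0
    (fun n t => w t * expR (- expR (n.+1%:R * (x - t)))) _ (fun t => `|w t|)) => //.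
  - exists [set x]; split => //; first by rewrite lebesgue_measure_set1.
    move=> t /=; apply: contra_notP => /eqP tx _.
    apply: cvgM; first exact: cvg_cst.
    have d0 : x - t != 0 by rewrite subr_eq0 eq_sym.
    rewrite (cvg_shiftS (fun n => expR (- expR (n%:R * (x - t))))).
    by have := double_exp_cvg d0; rewrite subr_lt0.
  - exact: integrable_norm.
  - move=> n t _; rewrite normrM ler_piMr// ger0_norm ?expR_ge0//.
rewrite (funext E) in cv.
have EE : \int[mu]_(t in D0) w t = \int[mu]_(t in D0) (w t * (x < t)%R%:R).
  exact: (cvg_unique _ (cvg_cst _) cv).
have sub : `[0, x]%classic `<=` D0.
  by move=> t; rewrite /D0/= !in_itv/= => /andP[->].
rewrite -(setIidr sub) Rintegral_mkcondr.
transitivity (\int[mu]_(t in D0) (w t - w t * (x < t)%R%:R)).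
  apply: eq_Rintegral => t; rewrite /D0 inE/= in_itv/= andbT => t0.
  rewrite patchE; case: ifPn.
    by rewrite inE/= in_itv/= t0/= ltNge => -> /=; rewrite mulr0 subr0.
  by rewrite notin_setE/= in_itv/= t0/= => /negP; rewrite -ltNge => -> /=;
    rewrite mulr1 subrr.
by rewrite RintegralB// EE subrr.
Qed.

Lemma laplace_zero_continuous w t : mu.-integrable D0 (EFin \o w) ->
  (forall q, 0 < q -> \int[mu]_(t in D0) (expR (- q * t) * w t) = 0) ->
  0 < t -> {for t, continuous w} -> w t = 0.
Proof.
move=> iw w0 t0 cw.
have iu : mu.-integrable `[0, t + 1] (EFin \o w).
  apply: integrable_mono iw => //.
  by move=> s; rewrite /D0/= !in_itv/= => /andP[->].
have [_ <-] := @continuous_FTC1 R w (BLeft 0) t (t + 1) (ltac:(lra)) iu t0 cw.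
rewrite derive1E; transitivity ('D_1 (cst (0 : R)) t); last exact: derive_cst.
apply: near_eq_derive.
near=> s; rewrite /cst; apply: laplace_zero_primitive => //.
by apply/ltW; near: s; exact: lt_nbhsr.
Unshelve. all: end_near. Qed.

End laplace_uniqueness.


(** * The Volterra equation of the second kind *)

Section geometric_limits.
Context {R : realType}.

Lemma geometric_small (C e : R) : 0 < e ->
  \forall n \near \oo, C * (2^-1) ^+ n < e.
Proof.
move=> e0.
have h : C * (2^-1) ^+ n @[n --> \oo] --> (0 : R).
  rewrite -[X in _ --> X](mulr0 C); apply: cvgM; first exact: cvg_cst.
  by apply: cvg_expr; rewrite ger0_norm; lra.
by move/cvgr0Pnorm_lt : h => /(_ e e0); apply: filterS => n; apply: le_lt_trans (ler_norm _).
Qed.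

Lemma geometric_eq0 (x C : R) : (forall n, `|x| <= C * (2^-1) ^+ n) -> x = 0.
Proof.
move=> H; apply/eqP; rewrite -normr_le0 leNgt; apply/negP => x0.
have [N _ /(_ N (leqnn N))] := geometric_small C x0.
by rewrite /= ltNge H.
Qed.

Lemma geometric_cauchy (u : nat -> R) (C : R) :
  (forall n m, `|u (n + m)%N - u n| <= C * (2^-1) ^+ n) ->
  exists l, u n @[n --> \oo] --> l /\ forall n, `|u n - l| <= C * (2^-1) ^+ n.
Proof.
move=> H.
have /cauchy_cvgP /cvg_ex[l ul] : cauchy (u @ \oo).
  apply: cauchy_exP => e e0.
  have [N _ /(_ N (leqnn N)) HN] := geometric_small C e0.
  exists (u N); exists N => // n /= Nn.
  by rewrite /ball/= distrC -(subnKC Nn) (le_lt_trans (H _ _)).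
exists l; split=> // n.
have cv : `|u n - u (n + m)%N| @[m --> \oo] --> `|u n - l|.
  apply: cvg_norm; apply: cvgB; first exact: cvg_cst.
  have : u (m + n)%N @[m --> \oo] --> l by rewrite (cvg_shiftn n u).
  by under eq_fun do rewrite addnC.
apply: (cvgr_to_le cv); apply: nearW => m.
by rewrite distrC.
Qed.

Lemma uniform_geometric (A : set R) (F : nat -> R -> R) (f : R -> R) (C : R) :
  (forall n t, A t -> `|F n t - f t| <= C * (2^-1) ^+ n) ->
  {uniform A, F n @[n --> \oo] --> f}.
Proof.
move=> H P /uniform_nbhs[E [+ sub]]; rewrite -entourage_ballE => -[e /= e0 eE].
have := geometric_small C e0; apply: filterS => n Cn; apply: sub => t /= At.
by apply: eE => /=; rewrite /ball/= distrC (le_lt_trans (H _ _ At)).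
Qed.

End geometric_limits.

Section volterra.
Context {R : realType}.
Notation mu := (@lebesgue_measure R).
Variables (a kappa sigma : R).
Hypotheses (a0 : 0 < a) (k0 : 0 < kappa) (s0 : 0 < sigma).
Hypothesis half : kappa * sigma `^ (- a) <= 2^-1.
Implicit Types (f g : R -> R) (M T t : R).

(** The ball of radius M of C(0, T) in the norm sup e^(-sigma t) |f(t)|. The
    weight, and not T, makes the convolution operator contracting. *)
Definition tame T M f := {within `[0, T], continuous f} /\
  forall s, 0 <= s <= T -> `|f s| <= M * expR (sigma * s).

Lemma tame_measurable T M f t : tame T M f -> t <= T -> measurable_fun `[0, t] f.
Proof.
move=> [cf _] tT; apply: subspace_continuous_measurable_fun.
  exact: measurable_itv.
apply: continuous_subspaceW cf => s /=; rewrite !in_itv/= => /andP[-> st].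
exact: le_trans tT.
Qed.

Lemma tame_integrable T M f t : tame T M f -> t <= T ->
  mu.-integrable `[0, t] (EFin \o (fun s => Phi a (t - s) * f s)).
Proof.
move=> tf tT; apply: (Phi_conv_integrable a0 s0 (tame_measurable tf tT)) => s /andP[s1 s2].
by apply: tf.2; rewrite s1 (le_trans s2).
Qed.

Lemma tame_conv_sub T M1 M2 f1 f2 t : tame T M1 f1 -> tame T M2 f2 -> t <= T ->
  Phi_conv a (fun s => f1 s - f2 s) t = Phi_conv a f1 t - Phi_conv a f2 t.
Proof.
move=> h1 h2 tT; rewrite /Phi_conv -RintegralB//; first last.
- exact: tame_integrable h2 tT.
- exact: tame_integrable h1 tT.
by apply: eq_Rintegral => s _; rewrite mulrBr.
Qed.

Lemma tame_conv_scale T M k f t : tame T M f -> t <= T ->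
  Phi_conv a (fun s => k * f s) t = k * Phi_conv a f t.
Proof.
move=> h1 tT; rewrite /Phi_conv -RintegralZl//; last exact: tame_integrable h1 tT.
by apply: eq_Rintegral => s _; rewrite mulrCA.
Qed.

Lemma tame_sub T M1 M2 f1 f2 : tame T M1 f1 -> tame T M2 f2 ->
  tame T (M1 + M2) (fun s => f1 s - f2 s).
Proof.
move=> [c1 b1] [c2 b2]; split.
  by move=> x; apply: cvgB; [exact: c1|exact: c2].
move=> s sT; rewrite mulrDl (le_trans (ler_normB _ _))// lerD//; [exact: b1|exact: b2].
Qed.

Lemma tame_scale T M k f : tame T M f -> tame T (`|k| * M) (fun s => k * f s).
Proof.
move=> [cf bf]; split.
  by move=> x; apply: cvgM; [exact: cvg_cst|exact: cf].
by move=> s sT; rewrite normrM -mulrA ler_wpM2l// bf.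
Qed.

Lemma tame_contract T M f : 0 <= T -> 0 <= M -> tame T M f ->
  tame T (2^-1 * M) (fun t => kappa * Phi_conv a f t).
Proof.
move=> T0 M0 tf; split.
  move=> x; apply: cvgM; first exact: cvg_cst.
  by apply: Phi_conv_within_continuous => //; exact: tf.1.
move=> t /andP[t0 tT]; rewrite normrM (gtr0_norm k0).
have h : `|Phi_conv a f t| <= sigma `^ (- a) * M * expR (sigma * t).
  apply: Phi_conv_bound => //; first exact: tame_measurable tf tT.
  by move=> s /andP[s1 s2]; apply: tf.2; rewrite s1 (le_trans s2).
apply: (@le_trans _ _ (kappa * (sigma `^ (- a) * M * expR (sigma * t)))).
  by rewrite ler_wpM2l// ltW.
by rewrite !mulrA -!(mulrA _ M) ler_wpM2r// mulr_ge0// expR_ge0.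
Qed.

Lemma tameW T M M' f : M <= M' -> tame T M f -> tame T M' f.
Proof.
move=> MM [cf bf]; split=> // s sT; rewrite (le_trans (bf s sT))//.
by rewrite ler_wpM2r// expR_ge0.
Qed.

Lemma tame_eq T M f1 f2 : (forall t, 0 <= t <= T -> f1 t = f2 t) ->
  tame T M f1 -> tame T M f2.
Proof.
move=> E [cf bf]; split=> [|s sT]; last by rewrite -E// bf.
apply: (@subspace_eq_continuous _ _ _ f1) cf => t.
by rewrite inE/= in_itv/=; exact: E.
Qed.

(** A fixed point of a contraction by 1/2 has norm at most M / 2^n for all n. *)
Lemma volterra_unique T M f : 0 <= T -> tame T M f ->
  (forall t, 0 <= t <= T -> f t = - (kappa * Phi_conv a f t)) ->
  forall t, 0 <= t <= T -> f t = 0.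
Proof.
move=> T0 tf fE.
have M0 : 0 <= M.
  have := tf.2 0; rewrite lexx T0 mulr0 expR0 mulr1 => /(_ isT).
  exact: le_trans.
have tn n : tame T (M * (2^-1) ^+ n) f.
  elim: n => [|n IH]; first by rewrite expr0 mulr1.
  have Mn : 0 <= M * (2^-1) ^+ n by rewrite mulr_ge0// exprn_ge0//; lra.
  have := tame_scale (-1) (tame_contract T0 Mn IH).
  rewrite normrN1 mul1r mulrCA -exprS; apply: tame_eq => t tT.
  by rewrite mulN1r fE.
move=> t tT; apply: (@geometric_eq0 _ _ (M * expR (sigma * t))) => n.
by rewrite mulrAC (tn n).2.
Qed.

Variables (g : R -> R) (M : R).
Hypothesis M0 : 0 <= M.
Hypothesis tg : forall T, 0 <= T -> tame T M g.

Fixpoint picard n : R -> R := match n with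
  | 0%N => fun t => kappa * Phi_conv a g t
  | m.+1 => fun t => - kappa * Phi_conv a (picard m) t + kappa * Phi_conv a g t
  end.

Lemma picardS n t : picard n.+1 t = kappa * Phi_conv a g t - kappa * Phi_conv a (picard n) t.
Proof. by rewrite /= mulNr addrC. Qed.

Lemma picard_tame n T : 0 <= T -> tame T M (picard n).
Proof.
move=> T0; have tg0 := tame_contract T0 M0 (tg T0).
elim: n => [|n IH]; first by apply: tameW tg0; have := M0; lra.
have := tame_sub tg0 (tame_contract T0 M0 IH).
by rewrite (_ : 2^-1 * M + 2^-1 * M = M); [apply: tame_eq => t _; rewrite picardS|lra].
Qed.

Lemma picard_step n T : 0 <= T ->
  tame T (M * (2^-1) ^+ n.+1) (fun t => picard n.+1 t - picard n t).
Proof.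
move=> T0; elim: n => [|n IH].
  have := tame_scale (-1) (tame_contract T0 M0 (picard_tame 0 T0)).
  rewrite normrN1 mul1r expr1 [M * _]mulrC; apply: tame_eq => t _.
  by rewrite picardS /=; ring.
have Mn : 0 <= M * (2^-1) ^+ n.+1 by rewrite mulr_ge0// exprn_ge0//; lra.
have := tame_scale (-1) (tame_contract T0 Mn IH).
rewrite normrN1 mul1r mulrCA -exprS; apply: tame_eq => t /andP[_ tT].
rewrite (tame_conv_sub (picard_tame n.+1 T0) (picard_tame n T0) tT).
by rewrite picardS [picard n.+1 t]picardS; ring.
Qed.

Lemma picard_cauchy n m t : 0 <= t ->
  `|picard (n + m) t - picard n t| <= M * expR (sigma * t) * (2^-1) ^+ n.
Proof.
move=> t0.
suff h : `|picard (n + m) t - picard n t| <=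
    M * expR (sigma * t) * ((2^-1) ^+ n - (2^-1) ^+ (n + m)).
  apply: (le_trans h); rewrite ler_wpM2l ?mulr_ge0 ?expR_ge0//.
  by rewrite gerBl exprn_ge0//; lra.
elim: m => [|m IH]; first by rewrite addn0 !subrr normr0 mulr0.
have := (picard_step (n + m) t0).2 t; rewrite lexx t0 => /(_ isT) hs.
rewrite addnS; set P := picard (n + m).+1 t in hs *; set Q := picard (n + m) t in hs IH.
have -> : P - picard n t = (P - Q) + (Q - picard n t) by ring.
rewrite (le_trans (ler_normD _ _))// (le_trans (lerD hs IH))//.
by rewrite exprS le_eqVlt; apply/orP; left; apply/eqP; field.
Qed.

(** The iterates differ from their limit by at most M e^(sigma t) / 2^n, a bound
    which is uniform on [0, T] and is halved by the convolution operator, so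
    that one may pass to the limit in the recursion. *)
Lemma volterra_solution : exists b : R -> R,
  (forall T, 0 <= T -> tame T M b) /\
  (forall t, 0 <= t -> b t = kappa * Phi_conv a g t - kappa * Phi_conv a b t) /\
  (forall T, 0 <= T -> {uniform `[0, T], picard n @[n --> \oo] --> b}).
Proof.
have lim t : exists l, 0 <= t ->
    forall n, `|picard n t - l| <= M * expR (sigma * t) * (2^-1) ^+ n.
  have [t0|t0] := boolP (0 <= t); last by exists 0.
  by have [l [_ hl]] := geometric_cauchy (fun n m => picard_cauchy n m t0); exists l.
have [b bE] := choice lim.
have ub T : 0 <= T -> {uniform `[0, T], picard n @[n --> \oo] --> b}.
  move=> T0; apply: (@uniform_geometric _ _ _ _ (M * expR (sigma * T))) => n t.
  rewrite /= in_itv/= => /andP[t0 tT]; apply: (le_trans (bE t t0 n)).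
  apply: ler_wpM2r; first by rewrite exprn_ge0.
  by rewrite ler_wpM2l// ler_expR ler_wpM2l// ltW.
have cb T : 0 <= T -> {within `[0, T], continuous b}.
  move=> T0; apply: (uniform_limit_continuous_subspace _ _ (ub T T0)).
  by exists 0%N => // n _; exact: (picard_tame n T0).1.
have tb T : 0 <= T -> tame T M b.
  move=> T0; split; first exact: cb.
  move=> t /andP[t0 tT]; apply/ler_addgt0Pr => e e0.
  have [N _ /(_ N (leqnn N)) HN] := geometric_small (M * expR (sigma * t)) e0.
  have -> : b t = picard N t - (picard N t - b t) by ring.
  rewrite (le_trans (ler_normB _ _))// lerD//.
    by apply: (picard_tame N T0).2; rewrite t0.
  by rewrite (le_trans (bE t t0 N))// ltW.
exists b; split=> //; split=> // t t0.
apply/eqP; rewrite -subr_eq0; apply/eqP.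
apply: (@geometric_eq0 _ _ (M * expR (sigma * t))) => n.
have tn : tame t (M * (2^-1) ^+ n) (fun t => picard n t - b t).
  split.
    by move=> x; apply: cvgB; [exact: (picard_tame n t0).1|exact: cb].
  by move=> s /andP[s1 _]; rewrite mulrAC; exact: bE.
have Mn : 0 <= M * (2^-1) ^+ n by rewrite mulr_ge0// exprn_ge0//; lra.
have := (tame_contract t0 Mn tn).2 t; rewrite lexx t0 => /(_ isT) h1.
have h2 := bE t t0 n.+1.
have -> : b t - (kappa * Phi_conv a g t - kappa * Phi_conv a b t) =
    - (picard n.+1 t - b t) - kappa * Phi_conv a (fun t => picard n t - b t) t.
  rewrite (tame_conv_sub (picard_tame n t0) (tb t t0) (lexx t)) picardS; ring.
rewrite (le_trans (ler_normB _ _))// normrN (le_trans (lerD h2 h1))//.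
by rewrite exprS le_eqVlt; apply/orP; left; apply/eqP; field.
Qed.

End volterra.


(** * The hyper-singular equation *)

Section hypersingular.
Context {R : realType}.
Notation mu := (@lebesgue_measure R).
Implicit Types (f g b : R -> R) (t T : R).

(** f(s) - f(t) is the product of the difference quotient, which converges, and
    of s - t, which tends to 0. *)
Lemma halfline_derivative_continuous f g : halfline_derivative f g ->
  {within `[0, +oo[, continuous f}.
Proof.
move=> fg; apply/subspace_continuousP => t; rewrite /= in_itv/= andbT => t0.
have q := fg t t0.
have c : (f s - f t) / (s - t) * (s - t) @[s --> within [set s | 0 <= s] t^'] --> g t * 0.
  apply: cvgM; first exact: q.
  have h0 : s - t @[s --> t] --> (0 : R).
    by rewrite -(subrr t); apply: cvgB; [exact: cvg_id|exact: cvg_cst].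
  apply: (cvg_trans _ h0).
  have h : within [set s : R | 0 <= s] t^' --> t.
    by apply: (cvg_trans (cvg_within _)); exact: cvg_within.
  exact: (cvg_app (fun s => s - t) h).
rewrite mulr0 in c.
apply/cvgrPdist_lt => e e0.
move/cvgr0Pnorm_lt : c => /(_ e e0).
rewrite !near_withinE; apply: filterS => s hs.
rewrite /from_subspace /= in_itv/= andbT => s0.
have [->|st] := eqVneq s t; first by rewrite subrr normr0.
by have := hs st s0; rewrite divfK ?subr_eq0// distrC.
Qed.

Lemma halfline_continuous f : (forall T, 0 <= T -> {within `[0, T], continuous f}) ->
  {within `[0, +oo[, continuous f}.
Proof.
move=> cf; apply/subspace_continuousP => t; rewrite /= in_itv/= andbT => t0.
have T0 : 0 <= t + 1 by lra.
have /subspace_continuousP /(_ t) := cf _ T0.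
rewrite /= in_itv/= t0 lerDl ler01 => /(_ isT)/cvgrPdist_lt h.
apply/cvgrPdist_lt => e /h; rewrite !near_withinE => hh.
near=> s => s0; apply: (near hh s _) => //=.
move: s0; rewrite /= !in_itv/= andbT => -> /=.
by apply: ltW; near: s; apply: lt_nbhsl; rewrite ltrDl.
Unshelve. all: end_near. Qed.

Lemma smooth_rapidly_decaying_tame f : smooth_rapidly_decaying f ->
  exists M, 0 <= M /\ forall sigma T, 0 < sigma -> 0 <= T -> tame sigma T M f.
Proof.
move=> [d [d0 dS dM]].
have [M HM] := dM 0%N 0%N; rewrite d0 in HM.
have fM t : 0 <= t -> `|f t| <= M by move=> t0; rewrite -[leLHS]mul1r -(expr0 t) HM.
have M0 : 0 <= M by rewrite (le_trans _ (fM 0 (lexx 0))).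
have cf : {within `[0, +oo[, continuous f}.
  by rewrite -d0; exact: halfline_derivative_continuous (dS 0%N).
exists M; split=> // sigma T s0 T0; split.
  by apply: continuous_subspaceW cf => t /=; rewrite !in_itv/= => /andP[->].
move=> t /andP[t0 _]; rewrite (le_trans (fM t t0))// ler_peMr//.
by rewrite -[leLHS]expR0 ler_expR mulr_ge0// ltW.
Qed.

(** The dominating function M e^(-(x - sigma) t) is integrable, being a multiple
    of Phi_1(t) e^(-(x - sigma) t). *)
Lemma laplace_integrable_tame sigma x M f : sigma < x ->
  (forall T, 0 <= T -> tame sigma T M f) -> laplace_integrable x f.
Proof.
move=> sx tf.
have mD : measurable (`[0, +oo[%classic : set R) by exact: measurable_itv.
have mf : measurable_fun (`[0, +oo[%classic : set R) f.
  apply: subspace_continuous_measurable_fun => //.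
  by apply: halfline_continuous => T T0; exact: (tf T T0).1.
have xs : 0 < x - sigma by lra.
have ie : mu.-integrable `[0, +oo[ (EFin \o (fun t => M * expR (- (x - sigma) * t))).
  apply: integrable_cmul => //.
  have i1 := laplace_integrable_Phi (@ltr01 R) xs.
  apply: (integrable_ext _ _ (integrable_cmul (Gamma 1) mD i1)) => //.
  move=> t; rewrite /= in_itv/= andbT => t0.
  by rewrite /Phi t0 subrr powRr0; field; rewrite gt_eqF// Gamma_gt0.
apply: (integrable_le _ _ ie) => //.
  apply: measurable_funM => //; apply: measurable_funTS.
  by apply: measurableT_comp => //; exact: mulrl_measurable.
move=> t; rewrite /= in_itv/= andbT => t0.
rewrite normrM ger0_norm ?expR_ge0// mulrC.
have -> : expR (- (x - sigma) * t) = expR (sigma * t) * expR (- x * t).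
  by rewrite -expRD; congr expR; ring.
by rewrite mulrA ler_wpM2r ?expR_ge0// (tf t t0).2// t0 lexx.
Qed.

Lemma eq_laplace f g p : (forall t, 0 <= t -> f t = g t) -> laplace f p = laplace g p.
Proof.
move=> fg; rewrite /laplace /cRintegral; congr Complex; apply: eq_Rintegral => t;
  by rewrite inE/= in_itv/= andbT => t0; rewrite fg.
Qed.

Lemma solution_on_subset (I J : set R) c b0 b : I `<=` J ->
  solution_on J c b0 b -> solution_on I c b0 b.
Proof.
move=> IJ [cb [u [v [ub uv bv]]]]; split; first exact: continuous_subspaceW cb.
exists u, v; split=> // t; rewrite inE => It; [apply: ub|apply: bv];
  by rewrite inE; exact: IJ.
Qed.

(** L(Phi_a * v) = p^(-a) p^a L(u) = L(u), and L is injective. Its injectivity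
    is used for the difference of the two sides damped by e^(-(sigma + 1) t),
    which is integrable. The Laplace transforms determine both sides up to a
    null set only; continuity at t gives the identity at t itself. *)
Lemma Phi_conv_laplace_inv a u v t : 0 < a -> Phi_conv_laplace (- a) u v ->
  0 < t -> {for t, continuous u} -> {for t, continuous (Phi_conv a v)} ->
  u t = Phi_conv a v t.
Proof.
move=> a0 [sigma [s0 iu iv E]] t0 cu cv.
have s1 : 0 < sigma + 1 by lra.
have ss : sigma <= sigma + 1 by lra.
have iu1 := laplace_integrableS ss iu.
have iv1 := laplace_integrableS ss iv.
have [ic1 _] := laplace_Phi_conv 0 a0 s1 iv1.
pose w t := expR (- (sigma + 1) * t) * u t - expR (- (sigma + 1) * t) * Phi_conv a v t.
have mD : measurable (`[0, +oo[%classic : set R) by exact: measurable_itv.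
have iw : mu.-integrable `[0, +oo[ (EFin \o w) by exact: integrable_sub.
have L0 q : 0 < q -> \int[mu]_(t in `[0, +oo[) (expR (- q * t) * w t) = 0.
  move=> q0.
  have sq : sigma <= sigma + 1 + q by lra.
  have sq0 : 0 < sigma + 1 + q by lra.
  have iuq := laplace_integrableS sq iu.
  have ivq := laplace_integrableS sq iv.
  have [icq Lc] := laplace_Phi_conv 0 a0 sq0 ivq.
  have Lv : laplace v (Complex (sigma + 1 + q) 0) =
      cpow (Complex (sigma + 1 + q) 0) (real_complex R a) *
      laplace u (Complex (sigma + 1 + q) 0).
    by rewrite E/= ?opprK//; lra.
  rewrite Lv mulrA cpow_mulVr// mul1r !laplaceE// in Lc.
  case: Lc => Lc _.
  transitivity (laplace_part cos u (sigma + 1 + q) 0 -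
    laplace_part cos (Phi_conv a v) (sigma + 1 + q) 0); last by rewrite Lc subrr.
  rewrite /laplace_part -RintegralB//.
  - apply: eq_Rintegral => r _; rewrite /w mulrBr !mul0r cos0 !mulr1 !mulrA -expRD.
    by have -> : - q * r + - (sigma + 1) * r = - (sigma + 1 + q) * r by ring.
  - by apply: laplace_part_integrable => //; [exact: continuous_cos|exact: cos_max].
  - by apply: laplace_part_integrable => //; [exact: continuous_cos|exact: cos_max].
have ce : {for t, continuous (fun t => expR (- (sigma + 1) * t))}.
  apply: (@continuous_comp _ _ _ (fun t => - (sigma + 1) * t) expR).
    exact: mulrl_continuous.
  exact: continuous_expR.
have cw : {for t, continuous w} by apply: cvgB; apply: cvgM.
have := laplace_zero_continuous iw L0 t0 cw.
rewrite /w -mulrBr => /eqP; rewrite mulf_eq0 gt_eqF ?expR_gt0//= subr_eq0.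
by move/eqP.
Qed.

Lemma within_zero_interior T f : 0 < T -> {within `[0, T], continuous f} ->
  (forall t, 0 < t < T -> f t = 0) -> forall t, 0 <= t <= T -> f t = 0.
Proof.
move=> T0 /(continuous_within_itvP _ T0)[_ c0 cT] f0 t /andP[t0 tT].
have [->|t0'] := eqVneq t 0.
  apply: (cvg_unique _ c0) => //; apply: cvg_near_cst; near=> s.
  by apply: f0; apply/andP; split.
have [->|tT'] := eqVneq t T.
  apply: (cvg_unique _ cT) => //; apply: cvg_near_cst; near=> s.
  by apply: f0; apply/andP; split.
by apply: f0; rewrite !lt_neqAle eq_sym t0' t0 tT' tT.
Unshelve. all: end_near. Qed.

End hypersingular.

Theorem theorem3p1 (R : realType) (c : R) (b0 : R -> R)
    (hc : 0 < c)
    (hb0 : smooth_rapidly_decaying b0)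
    (hneg : forall t : R, t < 0 -> b0 t = 0) :
  exists b : R -> R,
    solution_on `[0, +oo[ c b0 b /\
    forall T : R, 0 < T ->
      [/\ solution_on `[0, T] c b0 b,
          forall b' : R -> R, solution_on `[0, T] c b0 b' ->
            {in `[0, T], b' =1 b} &
          {uniform `[0, T], beta c b0 n @[n --> \oo] --> b}].
Proof.
pose a : R := 1 / 4.
have a0 : 0 < a by rewrite /a; lra.
pose kappa := (c * c1)^-1.
have cc0 : 0 < c * c1 by rewrite mulr_gt0// c1_gt0.
have k0 : 0 < kappa by rewrite invr_gt0.
(* The choice for which the contraction factor kappa sigma^(-a) is 1/2. *)
pose sigma := (2 * kappa) `^ (a^-1).
have s0 : 0 < sigma by rewrite powR_gt0// mulr_gt0.
have half : kappa * sigma `^ (- a) <= 2^-1.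
  rewrite /sigma -powRrM mulrN mulVf ?gt_eqF// powR_inv1 ?mulr_ge0 ?(ltW k0)//.
  by rewrite le_eqVlt; apply/orP; left; apply/eqP; field; rewrite gt_eqF.
have [M [M0 tb0']] := smooth_rapidly_decaying_tame hb0.
have tb0 T : 0 <= T -> tame sigma T M b0 by exact: tb0'.
have [b [tb [bE ub]]] := volterra_solution a0 k0 s0 half M0 tb0.
have betaE : beta c b0 = picard a kappa b0.
  apply/funext; elim=> [|n IH] //=.
  by apply/funext => t; rewrite IH.
pose v t := kappa * (b0 t - b t).
have tv T : 0 <= T -> tame sigma T (`|kappa| * (M + M)) v.
  by move=> T0; apply: tame_scale; apply: tame_sub; [exact: tb0|exact: tb].
have bv t : 0 <= t -> b t = Phi_conv a v t.
  move=> t0; rewrite /v.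
  rewrite (tame_conv_scale a0 s0 kappa (tame_sub (tb0 _ t0) (tb _ t0)) (lexx t)).
  by rewrite (tame_conv_sub a0 s0 (tb0 _ t0) (tb _ t0) (lexx t)) mulrBr -bE.
have sol : solution_on `[0, +oo[ c b0 b.
  split; first by apply: halfline_continuous => T T0; exact: (tb T T0).1.
  exists b, v; split=> //.
  - have s1 : sigma < sigma + 1 by lra.
    have ib := laplace_integrable_tame s1 tb.
    have iv := laplace_integrable_tame s1 tv.
    exists (sigma + 1); split=> //; first by lra.
    move=> [x y] /= sx; have x0 : 0 < x by lra.
    have ivx := laplace_integrableS (ltW sx) iv.
    rewrite opprK (eq_laplace _ bv) (laplace_Phi_conv y a0 x0 ivx).2.
    by rewrite mulrA [cpow _ _ * _]mulrC cpow_mulVr// mul1r.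
  - move=> t _; rewrite /v mulrA /kappa divff ?gt_eqF// mul1r; ring.
exists b; split=> // T T0.
have T0' := ltW T0.
have sub : `[0, T]%classic `<=` (`[0, +oo[%classic : set R).
  by move=> t /=; rewrite !in_itv/= => /andP[->].
split; first exact: solution_on_subset sub sol.
- move=> b' [cb' [u [v' [ub' uv' bv']]]].
  have inT t : 0 <= t <= T -> t \in (`[0, T]%classic : set R).
    by move=> tT; rewrite inE/= in_itv.
  have v'E t : 0 <= t <= T -> v' t = kappa * (b0 t - b' t).
    by move=> tT; rewrite (bv' t (inT t tT)) opprB addrC subrK /kappa mulKf ?gt_eqF.
  have cv' : {within `[0, T], continuous v'}.
    apply: (@subspace_eq_continuous _ _ _ (fun t => kappa * (b0 t - b' t))).
      by move=> t; rewrite inE/= in_itv/= => tT; exact/esym/v'E.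
    move=> x; apply: cvgM; first exact: cvg_cst.
    by apply: cvgB; [exact: (tb0 T T0').1|exact: cb'].
  have cc := Phi_conv_within_continuous a0 T0' cv'.
  (* The Laplace transforms give the identity where both sides are known to be
     continuous in the ordinary sense, in the interior; the end points follow
     by continuity on [0, T]. *)
  have b'E t : 0 <= t <= T -> b' t = Phi_conv a v' t.
    move=> tT; apply/eqP; rewrite -subr_eq0; apply/eqP.
    move: t tT; apply: within_zero_interior => //.
      by move=> x; apply: cvgB; [exact: cb'|exact: cc].
    move=> t tT; have /andP[t1 t2] := tT.
    have tT' : 0 <= t <= T by rewrite !ltW.
    have [cb1 _ _] := (continuous_within_itvP _ T0).1 cb'.
    have [cc1 _ _] := (continuous_within_itvP _ T0).1 cc.
    have tin : t \in `]0, T[ by rewrite in_itv.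
    rewrite -(ub' t (inT t tT')).
    rewrite (Phi_conv_laplace_inv a0 uv' t1) ?subrr//; last exact: cc1.
    apply: (cvg_trans _ (_ : b' s @[s --> t] --> u t)); last first.
      by rewrite (ub' t (inT t tT')); exact: cb1.
    apply: near_eq_cvg; near=> s; rewrite ub' //; apply: inT.
    by rewrite !ltW//; near: s; [exact: lt_nbhsl|exact: lt_nbhsr].
  have [M' tb'] : exists M', tame sigma T M' b'.
    have /compact_bounded[N [_ HN]] := continuous_compact cb' (@segment_compact _ 0 T).
    exists (`|N| + 1); split=> // s sT.
    rewrite (@le_trans _ _ (`|N| + 1))//.
      apply: HN; last by exists s => //=; rewrite in_itv.
      by rewrite (le_lt_trans (ler_norm _))// ltrDl.
    rewrite ler_peMr ?addr_ge0// -[leLHS]expR0 ler_expR.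
    by case/andP: sT => s1 _; rewrite mulr_ge0// ltW.
  move=> t; rewrite in_itv/= => tT; apply/eqP; rewrite -subr_eq0; apply/eqP.
  apply: (volterra_unique a0 k0 s0 half T0' (tame_sub tb' (tb T T0'))) tT => {}t tT.
  have /andP[t1 t2] := tT.
  rewrite (tame_conv_sub a0 s0 tb' (tb T T0') t2) bE// b'E//.
  have -> : Phi_conv a v' t = kappa * Phi_conv a b0 t - kappa * Phi_conv a b' t.
    rewrite -mulrBr -(tame_conv_sub a0 s0 (tb0 T T0') tb' t2).
    rewrite -(tame_conv_scale a0 s0 kappa (tame_sub (tb0 T T0') tb') t2).
    apply: eq_Rintegral => s; rewrite inE/= in_itv/= => /andP[s1 s2].
    by rewrite v'E// s1 (le_trans s2).
  ring.
- by rewrite betaE; exact: ub.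
Unshelve. all: end_near. Qed.
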